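(* Let $\epsilon\in\{1,-1\}$. (Direct part) Let $f_1\colon M_1\to\mathbb{E}^N$ be an immersion with $f_1(M_1)\subset\mathbb{Q}_\epsilon^{N-1}$. Let $E$ be a parallel flat subbundle of rank $s$ of $N_{f_1}M_1$ having the position vector field $f_1$ as a section, let $\phi\colon M_1\times\mathbb{E}^s\to E$ be a parallel vector bundle isometry, and let $e_1\in\mathbb{E}^s$ be such that $f_1(p_1)=\phi_{p_1}(e_1)$ for every $p_1\in M_1$. Let $f_0\colon M_0\to\mathbb{E}^s$ be an immersion with $f_0(M_0)\subset(e_1+\Omega(f_1;\phi))\cap\mathbb{Q}_\epsilon^{s-1}$, and define $f\colon M_0\times M_1\to\mathbb{E}^N$ by $f(p_0,p_1)=\phi_{p_1}(f_0(p_0))$. Then $f$ is an immersion into $\mathbb{Q}_\epsilon^{N-1}$ whose induced metric is polar and whose second fundamental form is adapted to the product net of $M_0\times M_1$. (Converse) Any immersion $f\colon M_0\times M_1\to\mathbb{Q}_\epsilon^{N-1}\subset\mathbb{E}^N$ whose induced metric is polar and whose second fundamental form is adapted to the product net is given in this way, i.e. there exist $f_1,E,\phi,e_1,f_0$ as in the direct part with $f(p_0,p_1)=\phi_{p_1}(f_0(p_0))$.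
   Context: Product manifolds are connected. $\mathbb{E}^N$ denotes Euclidean space $\mathbb{R}^N$ if $\epsilon=1$ and Lorentzian space $\mathbb{L}^N$ (signature $(-,+,\dots,+)$) if $\epsilon=-1$, and $\mathbb{Q}_\epsilon^{N-1}\subset\mathbb{E}^N$ is the unit sphere $\mathbb{S}^{N-1}$ if $\epsilon=1$, and hyperbolic space $\mathbb{H}^{N-1}=\{X:\langle X,X\rangle=-1,\ x_1>0\}$ if $\epsilon=-1$; similarly for $\mathbb{E}^s,\mathbb{Q}_\epsilon^{s-1}$. With $\pi_i\colon M_0\times M_1\to M_i$ the projections, a Riemannian metric $g$ on $M_0\times M_1$ is polar if $g=\pi_0^*g_0+\pi_1^*(g_1\circ\pi_0)$ for some Riemannian metric $g_0$ on $M_0$ and some smooth family $g_1=(g_1(p_0))_{p_0\in M_0}$ of Riemannian metrics on $M_1$ parametrized by $M_0$, i.e. $g(p)(X,Y)=g_0(\pi_{0*}X,\pi_{0*}Y)+g_1(\pi_0(p))(\pi_{1*}X,\pi_{1*}Y)$. The product net is $(E_0,E_1)$, with $E_i$ the tangent subbundle to the factor $M_i$; the second fundamental form $\alpha$ of an immersion of $M_0\times M_1$ is adapted to it if $\alpha(E_0,E_1)=0$. $N_{f_1}M_1$ denotes the normal bundle of $f_1$ as an immersion into $\mathbb{E}^N$, with its normal connection, and $A^{f_1}_\xi$ its shape operators, $\langle A^{f_1}_\xi X,Y\rangle=\langle\alpha_{f_1}(X,Y),\xi\rangle$. A parallel vector bundle isometry $\phi\colon M_1\times\mathbb{E}^s\to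 E$ is a smooth bundle map such that each $\phi_{p_1}=\phi(p_1,\cdot)\colon\mathbb{E}^s\to E(p_1)$ is a linear isometry and, for each fixed $y\in\mathbb{E}^s$, $p_1\mapsto\phi_{p_1}(y)$ is parallel in the normal connection. $\Omega(f_1;\phi)=\{Y\in\mathbb{E}^s:\ I-A^{f_1}_{\phi_{p_1}(Y)}\text{ is nonsingular on }T_{p_1}M_1\text{ for every }p_1\in M_1\}$.
   Formalization: In the direct part e_1 is also required to lie in Q_ε^{s-1}; this is automatic for ε=1, and for ε=-1 it fixes the sheet (x_1>0), without which f would map into the negative of hyperbolic space; in the converse this condition is proved. *)

(* Defs.v *)
(* MathComp / MathComp-Analysis, over an arbitrary [R : realType]. *)
From HB Require Import structures.
From mathcomp Require Import all_boot all_order all_algebra.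
From mathcomp Require Import all_classical all_reals all_analysis.

Set Implicit Arguments.
Unset Strict Implicit.
Unset Printing Implicit Defensive.

Import Order.TTheory GRing.Theory Num.Theory.
Import numFieldNormedType.Exports.

Local Open Scope classical_set_scope.
Local Open Scope ring_scope.

(** * Smooth maps on open subsets of normed spaces *)

(* Only meaningful for [U] open: the derivatives are two-sided. *)
Fixpoint Ck (R : realType) (V W : normedModType R) (k : nat)
    (U : set V) (h : V -> W) : Prop :=
  if k is j.+1 then
    (forall x, U x -> differentiable h x) /\
    (forall v : V, Ck j U (fun x => 'D_v h x))
  else forall x, U x -> {for x, continuous h}.

Definition smooth_on (R : realType) (V W : normedModType R)
    (U : set V) (h : V -> W) : Prop := forall k, Ck k U h.

(** * Manifolds, given by a smooth atlas *)

(* [coord] matters only on [dom], and [param] only on the image of [dom]. *)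
Record chart (R : realType) (M : topologicalType) (V : normedModType R) :=
  Chart { dom : set M; coord : M -> V; param : V -> M }.

Definition img (R : realType) (M : topologicalType) (V : normedModType R)
  (c : chart M V) : set V := coord c @` dom c.

Definition is_chart (R : realType) (M : topologicalType) (V : normedModType R)
    (c : chart M V) : Prop :=
  [/\ open (dom c),
      open (img c),
      forall p, dom c p -> param c (coord c p) = p,
      forall p, dom c p -> {for p, continuous (coord c)} &
      forall x, img c x -> {for x, continuous (param c)}].

Definition smooth_atlas (R : realType) (M : topologicalType)
    (V : normedModType R) (A : set (chart M V)) : Prop :=
  [/\ forall c, A c -> is_chart c,
      forall p, exists2 c, A c & dom c p &
      forall c c', A c -> A c' ->
        smooth_on (coord c @` (dom c `&` dom c')) (coord c' \o param c)].

Definition smooth_manifold (R : realType) (M : topologicalType)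
    (V : normedModType R) (A : set (chart M V)) : Prop :=
  [/\ hausdorff_space M, @second_countable M & smooth_atlas A].

(* The product manifold: a tangent vector is given, in a product chart, by a
   pair [X], with [X.1] tangent to [M0] and [X.2] tangent to [M1]. *)
Definition prod_chart (R : realType) (M0 M1 : topologicalType)
    (V0 V1 : normedModType R) (c0 : chart M0 V0) (c1 : chart M1 V1) :
    chart (M0 * M1)%type (V0 * V1)%type :=
  Chart (dom c0 `*` dom c1)
        (fun p => (coord c0 p.1, coord c1 p.2))
        (fun x => (param c0 x.1, param c1 x.2)).

Definition prod_atlas (R : realType) (M0 M1 : topologicalType)
    (V0 V1 : normedModType R) (A0 : set (chart M0 V0))
    (A1 : set (chart M1 V1)) : set (chart (M0 * M1)%type (V0 * V1)%type) :=
  [set c | exists c0 c1, [/\ A0 c0, A1 c1 & c = prod_chart c0 c1]].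

Definition smooth_map_on (R : realType) (M : topologicalType)
    (V W : normedModType R) (A : set (chart M V)) (U : set M)
    (f : M -> W) : Prop :=
  forall c, A c -> smooth_on (coord c @` (dom c `&` U)) (f \o param c).

(* A tangent vector at [p] is represented, for each chart [c] around [p], by its
   coordinate vector [u : V]; [pd c f u p] is the derivative of [f] at [p] along
   that vector.  As a function of [p], it is the derivative of [f] along the
   vector field with constant coordinates [u]. *)
Definition pd (R : realType) (M : topologicalType) (V W : normedModType R)
    (c : chart M V) (f : M -> W) (u : V) (p : M) : W :=
  'D_u (f \o param c) (coord c p).

Definition immersion (R : realType) (M : topologicalType)
    (V W : normedModType R) (A : set (chart M V)) (f : M -> W) : Prop :=
  smooth_map_on A [set: M] f /\
  forall c p, A c -> dom c p -> injective (fun u => pd c f u p).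

(** * Riemannian metrics and polar metrics *)

(* [g c p u v] is the value at [p] on the tangent vectors with coordinates
   [u], [v] in the chart [c]. *)
Definition form_field (R : realType) (M : topologicalType)
  (V : normedModType R) : Type := chart M V -> M -> V -> V -> R.

Definition riemannian_metric (R : realType) (M : topologicalType)
    (V : normedModType R) (A : set (chart M V)) (g : form_field M V) : Prop :=
  (forall c p, A c -> dom c p ->
    [/\ forall a u u' v, g c p (a *: u + u') v = a * g c p u v + g c p u' v,
        forall u v, g c p u v = g c p v u &
        forall u, u != 0 -> 0 < g c p u u]) /\
  (forall c c' p, A c -> A c' -> dom c p -> dom c' p -> forall u v,
    g c p u v = g c' p (pd c (coord c') u p) (pd c (coord c') v p)) /\
  forall c u v, A c -> smooth_on (img c) (fun x => g c (param c x) u v : R).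

Definition smooth_metric_family (R : realType) (M0 M1 : topologicalType)
    (V0 V1 : normedModType R) (A0 : set (chart M0 V0)) (A1 : set (chart M1 V1))
    (g1 : M0 -> form_field M1 V1) : Prop :=
  (forall p0, riemannian_metric A1 (g1 p0)) /\
  forall c0 c1 u v, A0 c0 -> A1 c1 ->
    smooth_on (img (prod_chart c0 c1))
      (fun x => g1 (param c0 x.1) c1 (param c1 x.2) u v : R).

Definition polar_metric (R : realType) (M0 M1 : topologicalType)
    (V0 V1 : normedModType R) (A0 : set (chart M0 V0)) (A1 : set (chart M1 V1))
    (g : form_field (M0 * M1)%type (V0 * V1)%type) : Prop :=
  exists (g0 : form_field M0 V0) (g1 : M0 -> form_field M1 V1),
    [/\ riemannian_metric A0 g0, smooth_metric_family A0 A1 g1 &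
        forall c0 c1 p0 p1, A0 c0 -> A1 c1 -> dom c0 p0 -> dom c1 p1 ->
        forall X Y : (V0 * V1)%type,
          g (prod_chart c0 c1) (p0, p1) X Y
          = g0 c0 p0 X.1 Y.1 + g1 p0 c1 p1 X.2 Y.2].

(** * The spaces [E^N] and [Q_eps^(N-1)] *)

Section Ambient.
Variables (R : realType) (eps : R) (N : nat).
Implicit Types (x y w : 'rV[R]_N) (T : set 'rV[R]_N).

(* Signature (eps, +, ..., +). *)
Definition dot x y : R :=
  \sum_(i < N) (if val i == 0%N then eps else 1) * (x 0 i * y 0 i).

Definition Q : set 'rV[R]_N :=
  [set x | dot x x = eps /\
     (eps = -1 -> forall i : 'I_N, val i = 0%N -> 0 < x 0 i)].

(* The tangent space at a point of [Q]. *)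
Definition tangentQ x : set 'rV[R]_N := [set w | dot w x = 0].

(* Orthogonal projections onto a nondegenerate subspace and onto its
   orthogonal complement. *)
Definition proj T w : 'rV[R]_N :=
  xget 0 [set t | T t /\ forall t', T t' -> dot (w - t) t' = 0].

Definition nproj T w : 'rV[R]_N := w - proj T w.

End Ambient.

Arguments Q {R} eps N.

(** * Submanifold geometry in [E^N] and [Q_eps^(N-1)] *)

Section Submanifold.
Variables (R : realType) (eps : R) (N : nat).
Variables (M : topologicalType) (V : normedModType R) (f : M -> 'rV[R]_N).
Implicit Types (c : chart M V) (p : M) (u v : V).

Definition induced_metric : form_field M V :=
  fun c p u v => dot eps (pd c f u p) (pd c f v p).

Definition tangent c p : set 'rV[R]_N := range (fun u => pd c f u p).

Definition normal_space c p : set 'rV[R]_N :=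
  [set xi | forall t, tangent c p t -> dot eps xi t = 0].

(* The second fundamental form of [f] as an immersion into [E^N]. *)
Definition sff c p u v : 'rV[R]_N :=
  nproj eps (tangent c p) (pd c (pd c f v) u p).

(* The second fundamental form of [f] as an immersion into [Q]: the
   Levi-Civita connection of [Q] is the tangential part of that of [E^N]. *)
Definition sffQ c p u v : 'rV[R]_N :=
  nproj eps (tangent c p)
    (proj eps (tangentQ eps (f p)) (pd c (pd c f v) u p)).

Definition shape_op c p (xi : 'rV[R]_N) u : V :=
  xget 0 [set w | forall v,
    induced_metric c p w v = dot eps (sff c p u v) xi].

(* The normal connection applied to a normal vector field. *)
Definition nabla_perp c u (xi : M -> 'rV[R]_N) : M -> 'rV[R]_N :=
  fun p => nproj eps (tangent c p) (pd c xi u p).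

Definition section_on (A : set (chart M V)) (E : M -> {vspace 'rV[R]_N})
    (U : set M) (xi : M -> 'rV[R]_N) : Prop :=
  smooth_map_on A U xi /\ forall p, U p -> xi p \in E p.

Definition normal_subbundle (A : set (chart M V)) (s : nat)
    (E : M -> {vspace 'rV[R]_N}) : Prop :=
  [/\ forall p, \dim (E p) = s,
      forall c p xi, A c -> dom c p -> xi \in E p -> normal_space c p xi &
      forall p, exists (U : set M) (b : 'I_s -> M -> 'rV[R]_N),
        [/\ open U, U p,
            forall i, section_on A E U (b i) &
            forall q, U q -> basis_of (E q) [seq b i q | i <- enum 'I_s]]].

Definition parallel_subbundle (A : set (chart M V))
    (E : M -> {vspace 'rV[R]_N}) : Prop :=
  forall U xi, open U -> section_on A E U xi ->
  forall c p u, A c -> dom c p -> U p -> nabla_perp c u xi p \in E p.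

(* Vanishing of the curvature tensor of the normal connection on [E]; the
   coordinate vector fields involved commute. *)
Definition flat_subbundle (A : set (chart M V))
    (E : M -> {vspace 'rV[R]_N}) : Prop :=
  forall U xi, open U -> section_on A E U xi ->
  forall c p u v, A c -> dom c p -> U p ->
    nabla_perp c u (nabla_perp c v xi) p = nabla_perp c v (nabla_perp c u xi) p.

Definition parallel_bundle_isometry (A : set (chart M V)) (s : nat)
    (E : M -> {vspace 'rV[R]_N}) (phi : M -> 'rV[R]_s -> 'rV[R]_N) : Prop :=
  [/\ forall c, A c -> smooth_on (img c `*` [set: 'rV[R]_s])
        (fun z : V * 'rV[R]_s => phi (param c z.1) z.2),
      forall p y, phi p y \in E p,
      forall p, linear (phi p),
      forall p y z, dot eps (phi p y) (phi p z) = dot eps y z &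
      forall c p u y, A c -> dom c p -> nabla_perp c u (fun q => phi q y) p = 0].

Definition Omega (A : set (chart M V)) (s : nat)
    (phi : M -> 'rV[R]_s -> 'rV[R]_N) : set 'rV[R]_s :=
  [set Y | forall c p, A c -> dom c p ->
     bijective (fun u => u - shape_op c p (phi p Y) u)].

End Submanifold.

(* The isometries [phi p1] already give [dot eps e1 e1 = eps], so [Q eps s e1]
   is void for [eps = 1]; for [eps = -1] it says that they preserve the time
   orientation.  Otherwise [p |-> phi p.2 (f0 p.1)] could land in the negative
   of hyperbolic space, e.g. for s = 1, e1 = -1, f0 = 1, phi p1 y = - y f1 p1. *)
Definition polar_data (R : realType) (eps : R) (N s : nat)
    (M0 M1 : topologicalType) (V0 V1 : normedModType R)
    (A0 : set (chart M0 V0)) (A1 : set (chart M1 V1))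
    (f1 : M1 -> 'rV[R]_N) (E : M1 -> {vspace 'rV[R]_N})
    (phi : M1 -> 'rV[R]_s -> 'rV[R]_N) (e1 : 'rV[R]_s)
    (f0 : M0 -> 'rV[R]_s) : Prop :=
  [/\ immersion A1 f1 /\ (forall p1, Q eps N (f1 p1)),
      [/\ normal_subbundle eps f1 A1 s E,
          parallel_subbundle eps f1 A1 E,
          flat_subbundle eps f1 A1 E &
          forall p1, f1 p1 \in E p1],
      parallel_bundle_isometry eps f1 A1 E phi,
      (forall p1, f1 p1 = phi p1 e1) /\ Q eps s e1 &
      immersion A0 f0 /\
      (forall p0, Omega eps f1 A1 phi (f0 p0 - e1) /\ Q eps s (f0 p0))].

Definition adapted_to_product (R : realType) (eps : R) (N : nat)
    (M0 M1 : topologicalType) (V0 V1 : normedModType R)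
    (A0 : set (chart M0 V0)) (A1 : set (chart M1 V1))
    (f : M0 * M1 -> 'rV[R]_N) : Prop :=
  forall c0 c1 p, A0 c0 -> A1 c1 -> dom c0 p.1 -> dom c1 p.2 ->
  forall (u0 : V0) (u1 : V1),
    sffQ eps f (prod_chart c0 c1) p (u0, 0) (0, u1) = 0.

Definition polar_adapted_immersion (R : realType) (eps : R) (N : nat)
    (M0 M1 : topologicalType) (V0 V1 : normedModType R)
    (A0 : set (chart M0 V0)) (A1 : set (chart M1 V1))
    (f : M0 * M1 -> 'rV[R]_N) : Prop :=
  [/\ immersion (prod_atlas A0 A1) f,
      forall p, Q eps N (f p),
      polar_metric A0 A1 (induced_metric eps f) &
      adapted_to_product eps A0 A1 f].

(* Main.v *)
(* Direct part: the derivative of a section [phi _ y] is tangent to [f1], and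
   equals [- f1_* A_(phi y)]; hence [f_*(u0, u1) = phi (f0_* u0)
   + f1_* (I - A_(phi (f0 - e1))) u1], an orthogonal sum, and the mixed second
   derivative of [f] is the derivative of such a section, so it is tangent to [f].

   Converse: polarity and adaptedness force the mixed second derivatives of [f]
   to be tangent to the slices [f (p0, _)]. Hence, [M0] being connected, the
   tangent space of the slice [f (p0, _)] at [p1] does not depend on [p0]. Put
   [f1 := f (o0, _)]. Every [f (p0, _)] is then a normal field of [f1] with
   tangential derivative, and the inner products of such fields are constant
   since [M1] is connected. A maximal orthonormal family [b] of such fields with
   [b 0 = f1] spans them all, because fields orthogonal to [f1] are spacelike;
   [E] is the span of [b], [phi] has matrix [b], and [f0 p0] consists of the
   constant coordinates of [f (p0, _)]. *)

Require Import Defs.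
From HB Require Import structures.
From mathcomp Require Import all_boot all_order all_algebra.
From mathcomp Require Import all_classical all_reals all_analysis.
From mathcomp Require Import ring lra.
(* [coord] and [proj] also name library constants. *)
Import Defs.
Set Implicit Arguments.
Unset Strict Implicit.
Unset Printing Implicit Defensive.
Import Order.TTheory GRing.Theory Num.Theory.
Import numFieldNormedType.Exports.
Local Open Scope classical_set_scope.
Local Open Scope ring_scope.

(** * Calculus of smooth maps *)

(** Although [dot] is indefinite for [eps = -1], every nonzero vector orthogonal to a point of the
    quadric is spacelike. The tangent spaces in play are therefore definite, so that the projections
    and shape operators chosen by [xget] are unique and can be computed by exhibiting a candidate.
    Both halves of polarity matter: the factors are orthogonal, and the [M0] block of the metric is
    independent of the point of [M1]. Commuting second derivatives in product charts replace the
    Levi-Civita connection and the Gauss and Codazzi equations. Constancy of the tangent spaces of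
    the slices is a uniqueness statement for a linear differential equation; normalizing a frame
    against a fixed right inverse reduces it to a vanishing derivative, hence to the mean value
    theorem. In the converse no flat connection is integrated: [E] is born with a global parallel
    frame, from which its rank, parallelism and flatness are read off. *)

Lemma open_near (T : topologicalType) (U : set T) (x : T) (P : T -> Prop) :
  open U -> U x -> (forall y, U y -> P y) -> \forall y \near x, P y.
Proof. by move=> oU Ux UP; apply: filterS UP _; exact: open_nbhs_nbhs. Qed.

Section Derivatives.
Context {R : realType}.
Implicit Types V W : normedModType R.

Lemma near_eq_differentiable V W (h h' : V -> W) (x : V) :
  (\forall y \near x, h y = h' y) -> differentiable h x -> differentiable h' x.
Proof.
move=> hh' dh.
have e : h' \o shift x = cst (h' x) + 'd h x +o_ 0 id.
  have [_ /eqaddoP he] := (diff_locallyP x h).1 dh.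
  apply/eqaddoP => e e0; have := he e e0.
  have hx : h x = h' x by exact: nbhs_singleton hh'.
  have hh : \forall y \near (0 : V), h (y + x) = h' (y + x).
    by move: hh'; rewrite (near_shift 0) subr0 /=.
  apply: filterS2 hh => y.
  by rewrite !fctE /= => <-; rewrite hx.
apply/diff_locallyP.
have E : 'd h' x = 'd h x :> (V -> W).
  exact: (diff_unique (df := 'd h x) (diff_continuous dh) e).
by rewrite E; split => //; exact: diff_continuous.
Qed.

(** The two difference quotients coincide before the limit is taken, so [h] may be differentiated
    along a line, a slice or a translate without being differentiable. *)
Lemma derive_affine V' V W (h : V -> W) (A : V' -> V) (x v : V') (v' : V) :
  (forall t : R, A (t *: v + x) = t *: v' + A x) ->
  'D_v (h \o A) x = 'D_v' h (A x).
Proof.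
move=> hA; rewrite /derive (_ : (fun t : R => _) =
  (fun t : R => t^-1 *: ((h \o shift (A x)) (t *: v') - h (A x)))) //.
by apply/funext => t /=; rewrite hA.
Qed.

Lemma derivable_affine V' V W (h : V -> W) (A : V' -> V) (x v : V') (v' : V) :
  (forall t : R, A (t *: v + x) = t *: v' + A x) ->
  derivable h (A x) v' -> derivable (h \o A) x v.
Proof.
move=> hA; rewrite /derivable => H; rewrite (_ : (fun t : R => _) =
  (fun t : R => t^-1 *: ((h \o shift (A x)) (t *: v') - h (A x)))) //.
by apply/funext => t /=; rewrite hA.
Qed.

Lemma derive_chain V' V W (h : V -> W) (k : V' -> V) (x v : V') :
  differentiable k x -> differentiable h (k x) ->
  'D_v (h \o k) x = 'D_('D_v k x) h (k x).
Proof.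
move=> dk dh; rewrite !deriveE //; last exact: differentiable_comp.
by rewrite diff_comp.
Qed.

Lemma derive_lin V W W' (L : {linear W -> W'}) (h : V -> W) (x v : V) :
  continuous L -> differentiable h x -> 'D_v (L \o h) x = L ('D_v h x).
Proof.
move=> cL dh.
rewrite !deriveE //; last by apply: differentiable_comp => //; exact: linear_differentiable.
by rewrite diff_comp //= ?diff_lin//; exact: linear_differentiable.
Qed.

Lemma is_diff_scale V W (a : V -> R) (w : V -> W) (x : V) :
  differentiable a x -> differentiable w x ->
  is_diff x (fun y => a y *: w y) (fun v => a x *: 'd w x v + 'd a x v *: w x).
Proof.
move=> da dw.
(* Scaling is repackaged as a continuous bilinear map, whose differential is known; the product rule
   is then the chain rule through the pair [(a, w)]. *)
have Bb : bilinear_for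
    (GRing.Scale.Law.clone _ _ *:%R _) (GRing.Scale.Law.clone _ _ *:%R _)
    (@GRing.scale R W).
  split=> [u'|u] c y z /=; first by rewrite scalerDl scalerA.
  by rewrite scalerDr !scalerA mulrC.
pose BM := bilinear_isBilinear.Build R R W W _ _ (@GRing.scale R W) Bb.
pose B : {bilinear R -> W -> W} := HB.pack (@GRing.scale R W) BM.
have cB : continuous (fun p : R * W => B p.1 p.2) by move=> p; exact: scale_continuous.
have dB (p : R * W) : is_diff p (fun q : R * W => q.1 *: q.2)
    (fun q => p.1 *: q.2 + q.1 *: p.2).
  apply: DiffDef; first exact: (differentiable_bilin (f := B)).
  by rewrite (diff_bilin (f := B)).
have Hp : is_diff x (fun y => (a y, w y)) (fun v => ('d a x v, 'd w x v)).
  by apply: is_diff_pair; exact: differentiableP.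
exact: (is_diff_comp Hp (dB (a x, w x))).
Qed.

Lemma differentiable_scale V W (a : V -> R) (w : V -> W) (x : V) :
  differentiable a x -> differentiable w x ->
  differentiable (fun y => a y *: w y) x.
Proof. by move=> da dw; have [] := is_diff_scale da dw. Qed.

Lemma derive_scale V W (a : V -> R) (w : V -> W) (x v : V) :
  differentiable a x -> differentiable w x ->
  'D_v (fun y => a y *: w y) x = a x *: 'D_v w x + 'D_v a x *: w x.
Proof.
move=> da dw; rewrite deriveE; last exact: differentiable_scale.
have H := is_diff_scale da dw.
by rewrite diff_val !deriveE.
Qed.

End Derivatives.

(** * Closure properties of maps of class C^k *)

Section Smooth.
Context {R : realType}.
Implicit Types V W : normedModType R.

Lemma Ck_eq V W k (U : set V) (h h' : V -> W) :
  open U -> (forall x, U x -> h x = h' x) -> Ck k U h -> Ck k U h'.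
Proof.
move=> oU; elim: k h h' => [|k IH] h h' hh' /=.
  move=> ch x Ux; change (h' @ x --> h' x); rewrite -(hh' x Ux).
  apply: cvg_trans (ch x Ux); apply: near_eq_cvg.
  exact: open_near oU Ux hh'.
case=> dh Dh; split=> [x Ux|v].
  by apply: near_eq_differentiable (dh x Ux); exact: open_near oU Ux hh'.
apply: (IH _ _ _ (Dh v)) => x Ux.
by apply: near_eq_derive; exact: open_near oU Ux hh'.
Qed.

Lemma Ck_sub V W k (U U' : set V) (h : V -> W) : U' `<=` U -> Ck k U h -> Ck k U' h.
Proof.
move=> UU'; elim: k h => [|k IH] h /=; first by move=> ch x /UU'; exact: ch.
case=> dh Dh; split=> [x /UU'|v]; first exact: dh.
by apply: IH; exact: Dh.
Qed.

Lemma Ck_cst V W k (U : set V) (w : W) : Ck k U (fun _ => w).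
Proof.
elim: k w => [|k IH] w /=; first by move=> x _; exact: cvg_cst.
split=> [x _|v]; first exact: differentiable_cst.
have -> : (fun x => 'D_v (fun=> w) x) = (fun=> 0 : W); last exact: IH.
by apply/funext => x; exact: derive_cst.
Qed.

Lemma CkD V W k (U : set V) (h h' : V -> W) : open U ->
  Ck k U h -> Ck k U h' -> Ck k U (fun x => h x + h' x).
Proof.
move=> oU; elim: k h h' => [|k IH] h h' /=.
  by move=> ch ch' x Ux; apply: cvgD; [exact: ch|exact: ch'].
move=> [dh Dh] [dh' Dh']; split=> [x Ux|v].
  by apply: differentiableD; [exact: dh|exact: dh'].
apply: (Ck_eq oU _ (IH _ _ (Dh v) (Dh' v))) => x Ux /=.
by rewrite deriveD //; apply: diff_derivable; [exact: dh|exact: dh'].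
Qed.

Lemma Ck_pred V W k (U : set V) (h : V -> W) : Ck k.+1 U h -> Ck k U h.
Proof.
elim: k h => [|k IH] h; first by case=> dh _ x Ux; exact/differentiable_continuous/dh.
by case=> dh Dh; split=> // v; exact/IH/Dh.
Qed.

Lemma Ck_scale V W k (U : set V) (a : V -> R) (w : V -> W) : open U ->
  Ck k U a -> Ck k U w -> Ck k U (fun x => a x *: w x).
Proof.
move=> oU; elim: k a w => [|k IH] a w.
  by move=> ca cw x Ux; apply: cvgZ; [exact: ca|exact: cw].
move=> Ca Cw; have [da Da] := Ca; have [dw Dw] := Cw; split=> [x Ux|v].
  by apply: differentiable_scale; [exact: da|exact: dw].
have Ck1 : Ck k U (fun x => a x *: 'D_v w x + 'D_v a x *: w x).
  by apply: CkD => //; apply: IH;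
    [exact: Ck_pred|exact: Dw|exact: Da|exact: Ck_pred].
apply: (Ck_eq oU _ Ck1) => x Ux.
by rewrite derive_scale //; [exact: da|exact: dw].
Qed.

Lemma Ck_lin V W W' k (U : set V) (L : {linear W -> W'}) (h : V -> W) : open U ->
  continuous L -> Ck k U h -> Ck k U (fun x => L (h x)).
Proof.
move=> oU cL; elim: k h => [|k IH] h /=.
  by move=> ch x Ux; apply: (@continuous_comp _ _ _ h L); [exact: ch|exact: cL].
case=> dh Dh; split=> [x Ux|v].
  by apply: (differentiable_comp (dh x Ux)); exact: linear_differentiable.
apply: (Ck_eq oU _ (IH _ (Dh v))) => x Ux.
by rewrite -(derive_lin _ cL) //; exact: dh.
Qed.

(** A directional derivative of [h] after an affine map is again a directional derivative of [h]
    after the same map, so the induction stays within composites of this shape. *)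
Lemma Ck_affine V' V W k (U : set V) (h : V -> W) (L : {linear V' -> V}) (c : V) :
  continuous L -> Ck k U h -> Ck k [set y | U (L y + c)] (fun y => h (L y + c)).
Proof.
move=> cL.
have dA (y : V') : differentiable (fun y => L y + c) y.
  by apply: differentiableD; [exact: linear_differentiable|exact: differentiable_cst].
elim: k h => [|k IH] h /=.
  move=> ch y Uy; apply: (@continuous_comp _ _ _ (fun y => L y + c)); last exact: ch.
  exact: differentiable_continuous.
case=> dh Dh; split=> [y Uy|v].
  by apply: (differentiable_comp (dA y)); exact: dh.
have -> : (fun x => 'D_v (fun y => h (L y + c)) x) =
    (fun y => 'D_(L v) h (L y + c)); last exact: (IH _ (Dh (L v))).
apply/funext => y; apply: (@derive_affine _ _ _ _ h (fun y => L y + c)) => t.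
by rewrite linearD linearZ addrA.
Qed.

End Smooth.

Section SmoothOn.
Context {R : realType}.
Implicit Types V W : normedModType R.

Lemma smooth_diff V W (U : set V) (h : V -> W) (x : V) :
  smooth_on U h -> U x -> differentiable h x.
Proof. by move=> sh; have [dh _] := sh 1%N; exact: dh. Qed.

Lemma smooth_D V W (U : set V) (h : V -> W) (v : V) :
  smooth_on U h -> smooth_on U ('D_v h).
Proof. by move=> sh k; have [_] := sh k.+1; exact. Qed.

Lemma smooth_eq V W (U : set V) (h h' : V -> W) :
  open U -> (forall x, U x -> h x = h' x) -> smooth_on U h -> smooth_on U h'.
Proof. by move=> oU hh' sh k; exact: Ck_eq oU hh' (sh k). Qed.

Lemma smooth_sub V W (U U' : set V) (h : V -> W) :
  U' `<=` U -> smooth_on U h -> smooth_on U' h.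
Proof. by move=> UU' sh k; exact: Ck_sub UU' (sh k). Qed.

Lemma smooth_cst V W (U : set V) (w : W) : smooth_on U (fun _ => w).
Proof. by move=> k; exact: Ck_cst. Qed.

Lemma smoothD V W (U : set V) (h h' : V -> W) : open U ->
  smooth_on U h -> smooth_on U h' -> smooth_on U (fun x => h x + h' x).
Proof. by move=> oU sh sh' k; exact: CkD. Qed.

Lemma smooth_scale V W (U : set V) (a : V -> R) (w : V -> W) : open U ->
  smooth_on U a -> smooth_on U w -> smooth_on U (fun x => a x *: w x).
Proof. by move=> oU sa sw k; exact: Ck_scale. Qed.

Lemma smoothM V (U : set V) (a b : V -> R) : open U ->
  smooth_on U a -> smooth_on U b -> smooth_on U (fun x => a x * b x).
Proof. by move=> oU sa sw k; exact: (@Ck_scale _ _ R). Qed.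

Lemma smooth_lin V W W' (U : set V) (L : {linear W -> W'}) (h : V -> W) : open U ->
  continuous L -> smooth_on U h -> smooth_on U (fun x => L (h x)).
Proof. by move=> oU cL sh k; exact: Ck_lin. Qed.

Lemma smooth_affine V' V W (U : set V) (h : V -> W) (L : {linear V' -> V}) (c : V) :
  continuous L -> smooth_on U h ->
  smooth_on [set y | U (L y + c)] (fun y => h (L y + c)).
Proof. by move=> cL sh k; exact: Ck_affine. Qed.

Lemma smooth_sum V W (U : set V) (I : Type) (r : seq I) (F : I -> V -> W) : open U ->
  (forall i, smooth_on U (F i)) -> smooth_on U (fun x => \sum_(i <- r) F i x).
Proof.
move=> oU sF; elim: r => [|i r IH].
  by apply: smooth_eq oU _ (@smooth_cst _ _ U 0) => x _; rewrite big_nil.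
by apply: smooth_eq oU _ (smoothD oU (sF i) IH) => x _; rewrite big_cons.
Qed.

Lemma smooth_id V (U : set V) : smooth_on U id.
Proof.
case=> [|k] /=; first by move=> x _; exact: cvg_id.
split=> [x _|v]; first exact: ex_diff.
have -> : (fun x => 'D_v id x) = (fun=> v) by apply/funext => x; exact: derive_id.
exact: Ck_cst.
Qed.

Lemma differentiable_bigsum V W (I : Type) (r : seq I) (P : pred I)
    (F : I -> V -> W) (x : V) :
  (forall i, differentiable (F i) x) ->
  differentiable (fun x => \sum_(i <- r | P i) F i x) x.
Proof.
move=> dF; elim: r => [|i r IH].
  by under eq_fun do rewrite big_nil; exact: differentiable_cst.
under eq_fun do rewrite big_cons.
by case: (P i) => //; apply: differentiableD.
Qed.

Lemma derive_bigsum V W (I : Type) (r : seq I) (F : I -> V -> W) (x v : V) :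
  (forall i, differentiable (F i) x) ->
  'D_v (fun x => \sum_(i <- r) F i x) x = \sum_(i <- r) 'D_v (F i) x.
Proof.
move=> dF; elim: r => [|i r IH].
  by rewrite big_nil; under eq_fun do rewrite big_nil; exact: derive_cst.
under eq_fun do rewrite big_cons.
rewrite big_cons -IH (deriveD (f := F i)) //; apply: diff_derivable => //.
exact: differentiable_bigsum.
Qed.

Lemma differentiable_bigprod V (I : Type) (r : seq I) (P : pred I)
    (F : I -> V -> R) (x : V) :
  (forall i, differentiable (F i) x) ->
  differentiable (fun x => \prod_(i <- r | P i) F i x) x.
Proof.
move=> dF; elim: r => [|i r IH].
  by under eq_fun do rewrite big_nil; exact: differentiable_cst.
under eq_fun do rewrite big_cons.
by case: (P i) => //; apply: differentiableM.
Qed.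

End SmoothOn.

(** * Coordinates and scalar products of vector-valued maps *)

Section Coordinates.
Context {R : realType}.
Implicit Types V W : normedModType R.

Definition coef n (i : 'I_n) (x : 'rV[R]_n) : R := x 0 i.

Lemma coef_is_linear n (i : 'I_n) : linear (@coef n i).
Proof. by move=> a x y; rewrite /coef !mxE. Qed.

HB.instance Definition _ n (i : 'I_n) :=
  GRing.isLinear.Build R 'rV[R]_n R _ (@coef n i) (@coef_is_linear n i).

Lemma smooth_coef V n (U : set V) (h : V -> 'rV[R]_n) i : open U ->
  smooth_on U h -> smooth_on U (fun x => h x 0 i).
Proof.
move=> oU sh; apply: (@smooth_lin _ _ _ _ _ (@coef n i)) => //.
exact: coord_continuous.
Qed.

Lemma derive_coef V n (h : V -> 'rV[R]_n) i (x v : V) :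
  differentiable h x -> 'D_v (fun x => h x 0 i) x = 'D_v h x 0 i.
Proof.
move=> dh; apply: (@derive_lin _ _ _ _ (@coef n i) h) => //.
exact: coord_continuous.
Qed.

Lemma differentiable_coef V n (h : V -> 'rV[R]_n) i (x : V) :
  differentiable h x -> differentiable (fun x => h x 0 i) x.
Proof.
move=> dh; exact: (differentiable_comp dh (differentiable_coord _ _ _)).
Qed.

Lemma smooth_dot V (eps : R) n (U : set V) (a b : V -> 'rV[R]_n) : open U ->
  smooth_on U a -> smooth_on U b -> smooth_on U (fun x => dot eps (a x) (b x)).
Proof.
move=> oU sa sb; apply: smooth_sum => // i.
apply: smoothM => //; first exact: smooth_cst.
by apply: smoothM => //; exact: smooth_coef.
Qed.

Lemma derive_dot V (eps : R) n (a b : V -> 'rV[R]_n) (x v : V) :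
  differentiable a x -> differentiable b x ->
  'D_v (fun x => dot eps (a x) (b x)) x
  = dot eps ('D_v a x) (b x) + dot eps (a x) ('D_v b x).
Proof.
move=> da db; rewrite /dot.
have dab i : differentiable (fun x => a x 0 i * b x 0 i) x.
  by apply: differentiableM; exact: differentiable_coef.
rewrite derive_bigsum; last first.
  by move=> i; apply: (@differentiable_scale _ _ R (fun=> _)).
rewrite -big_split /=; apply: eq_bigr => i _.
rewrite (@derive_scale _ _ R (fun=> _) (fun x => a x 0 i * b x 0 i)) //.
rewrite derive_cst scale0r addr0.
rewrite (@derive_scale _ _ R (fun x => a x 0 i) (fun x => b x 0 i));
  [|exact: differentiable_coef..].
rewrite !derive_coef // -mulrDr; congr (_ * _).
by rewrite addrC.
Qed.

End Coordinates.

(** * Mean values and symmetry of second derivatives *)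

Section MeanValue.
Context {R : realType}.
Implicit Types V : normedModType R.

Lemma is_derive_line V (h : V -> R) (y v : V) (t : R) :
  differentiable h (t *: v + y) ->
  is_derive t 1 (fun s : R => h (s *: v + y)) ('D_v h (t *: v + y)).
Proof.
move=> dh.
have E : forall s : R, (s *: (1 : R) + t) *: v + y = s *: v + (t *: v + y).
  by move=> s; rewrite scalerDl -scalerA scale1r addrA.
apply: DeriveDef; last exact: (@derive_affine _ _ _ _ h (fun s : R => s *: v + y)).
apply: (@derivable_affine _ _ _ _ h (fun s : R => s *: v + y) _ _ v) => //.
exact: diff_derivable.
Qed.

Lemma line_mean_value V (h : V -> R) (y v : V) (t : R) : 0 <= t ->
  (forall s, 0 <= s <= t -> differentiable h (s *: v + y)) ->
  exists2 s, 0 <= s <= t & h (t *: v + y) - h y = t * 'D_v h (s *: v + y).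
Proof.
move=> t0 dh.
have [||s st] := @MVT_segment R (fun s : R => h (s *: v + y))
    (fun s => 'D_v h (s *: v + y)) 0 t t0.
- move=> s; rewrite in_itv /= => /andP[s0 st]; apply/is_derive_line/dh.
  by rewrite !ltW.
- apply: derivable_within_continuous => s; rewrite in_itv /= => st.
  by have [] := is_derive_line (dh s st).
rewrite scale0r add0r subr0 => E; exists s; last by rewrite E mulrC.
by move: st; rewrite in_itv.
Qed.

Lemma derive_eq0_const V (h : V -> R) (x y : V) :
  (forall s : R, 0 <= s <= 1 -> differentiable h (s *: (y - x) + x) /\
     'D_(y - x) h (s *: (y - x) + x) = 0) -> h y = h x.
Proof.
move=> H; have [s /H[//]|s /H[_ Ds]] := @line_mean_value V h x (y - x) 1 ler01.
by rewrite scale1r subrK Ds mulr0 => /eqP; rewrite subr_eq0 => /eqP.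
Qed.

Lemma ball_segment V (x y : V) (r s : R) : ball x r y -> 0 <= s <= 1 ->
  ball x r (s *: (y - x) + x).
Proof.
rewrite -ball_normE /ball_ /= => xy /andP[s0 s1].
rewrite opprD addrCA subrr addr0 normrN normrZ ger0_norm // distrC.
by rewrite (le_lt_trans _ xy) // ler_piMl.
Qed.

(** The second difference is the increment along [u] of [g y = h (t *: v + y) - h y]: one mean value
    along [u], then one along [v]. Its left side is symmetric in [u] and [v], which is the source of
    the symmetry of second derivatives. *)
Lemma mixed_difference V (h : V -> R) (x u v : V) (t : R) : 0 <= t ->
  (forall s r : R, 0 <= s <= t -> 0 <= r <= t ->
     differentiable h (s *: u + (r *: v + x)) /\
     differentiable ('D_u h) (s *: u + (r *: v + x))) ->
  exists s r : R, [/\ 0 <= s <= t, 0 <= r <= t &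
    h (t *: u + (t *: v + x)) - h (t *: u + x) - (h (t *: v + x) - h x)
    = t * (t * 'D_v ('D_u h) (s *: u + (r *: v + x)))].
Proof.
move=> t0 dh.
have t0t : 0 <= t <= t by rewrite t0 lexx.
have z0t : (0 : R) <= 0 <= t by rewrite lexx t0.
pose g := fun y => h (t *: v + y) - h y.
have shift_affine y : forall k : R, t *: v + (k *: u + y) = k *: u + (t *: v + y).
  by move=> k; rewrite addrCA.
have dsh y : differentiable h (t *: v + y) -> differentiable (fun y => h (t *: v + y)) y.
  move=> d; apply: (@differentiable_comp _ _ _ _ (fun y => t *: v + y) h) => //.
have dg s : 0 <= s <= t -> differentiable h (t *: v + (s *: u + x)) /\
    differentiable h (s *: u + x).
  move=> st; rewrite shift_affine; split; first exact: (dh s t st t0t).1.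
  by have := (dh s 0 st z0t).1; rewrite scale0r add0r.
have [s st|s st E1] := @line_mean_value V g x u t t0.
  have [d1 d2] := dg s st.
  by apply: differentiableB => //; exact: dsh.
have [d1 d2] := dg s st.
have Dg : 'D_u g (s *: u + x) = 'D_u h (t *: v + (s *: u + x)) - 'D_u h (s *: u + x).
  rewrite (@deriveB _ _ _ (fun y => h (t *: v + y)) h); last 2 first.
  - by apply: diff_derivable; exact: dsh.
  - exact: diff_derivable.
  by rewrite (@derive_affine _ _ _ _ h (fun y => t *: v + y) _ _ u).
have [r rt|r rt E2] := @line_mean_value V ('D_u h) (s *: u + x) v t t0.
  by rewrite addrCA; exact: (dh s r st rt).2.
exists s, r; split => //.
by rewrite [s *: u + _]addrCA -E2 -Dg -E1 /g [t *: u + (_ + _)]addrCA.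
Qed.

Lemma continuous_ball2 V (U : set V) (F G : V -> R) (x : V) (e : R) : open U -> U x ->
  {for x, continuous F} -> {for x, continuous G} -> 0 < e ->
  exists2 r : R, 0 < r & forall y, ball x r y ->
    [/\ U y, `|F x - F y| < e & `|G x - G y| < e].
Proof.
move=> oU Ux cF cG e0.
have nF : \forall y \near x, `|F x - F y| < e by move/cvgrPdist_lt : cF; apply.
have nG : \forall y \near x, `|G x - G y| < e by move/cvgrPdist_lt : cG; apply.
have nU : \forall y \near x, U y by exact: open_near oU Ux _.
have [r /= r0 H] := (nbhs_ballP x _).1 (filterI nU (filterI nF nG)).
by exists r => // y /H[? []].
Qed.

(** Both mixed derivatives reproduce the same second difference, at two points near [x]. If they
    differed by [e] at [x], continuity within [e / 2] at these points would give [e < e]. *)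
Lemma derive_symm_scalar V (U : set V) (h : V -> R) (x u v : V) : open U ->
  smooth_on U h -> U x -> 'D_u ('D_v h) x = 'D_v ('D_u h) x.
Proof.
move=> oU sh Ux; apply: contrapT => /eqP; rewrite -subr_eq0 -normr_gt0.
set F := 'D_u ('D_v h); set G := 'D_v ('D_u h).
set e := `| _ | => e0.
have e2 : 0 < e / 2 by rewrite divr_gt0.
have cF : F @ x --> F x.
  by apply: differentiable_continuous; apply: smooth_diff Ux; do 2 apply: smooth_D.
have cG : G @ x --> G x.
  by apply: differentiable_continuous; apply: smooth_diff Ux; do 2 apply: smooth_D.
have [r r0 Hr] := continuous_ball2 oU Ux cF cG e2.
(* The summand 1 keeps [K] positive when [u] and [v] vanish; with [t = r / 2 / K] the whole
   parallelogram stays within distance [r / 2] of [x]. *)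
set K := `|u| + `|v| + 1.
have K0 : 0 < K by rewrite /K ltr_wpDl // addr_ge0.
pose t := r / 2 / K.
have t0 : 0 < t by rewrite !divr_gt0.
have inb s q : 0 <= s <= t -> 0 <= q <= t -> ball x r (s *: u + (q *: v + x)).
  move=> /andP[s0 st] /andP[q0 qt]; rewrite -ball_normE /ball_ /= addrA opprD addrCA subrr addr0.
  rewrite normrN (le_lt_trans (ler_normD _ _)) // !normrZ !ger0_norm //.
  have : s * `|u| + q * `|v| <= t * `|u| + t * `|v| by rewrite lerD // ler_wpM2r.
  have : t * `|u| + t * `|v| <= t * K.
    by rewrite -mulrDr ler_pM2l // /K lerDl.
  rewrite {3}/t divfK ?gt_eqF // => A B.
  apply: le_lt_trans B _; apply: le_lt_trans A _; lra.
have [|s1 [q1 [s1t q1t E1]]] := @mixed_difference V h x u v t (ltW t0).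
  move=> s q st qt; have [Uy _ _] := Hr _ (inb _ _ st qt).
  by split; [exact: smooth_diff sh _|apply: smooth_diff Uy; exact: smooth_D].
have [|s2 [q2 [s2t q2t E2]]] := @mixed_difference V h x v u t (ltW t0).
  move=> s q st qt; rewrite addrCA; have [Uy _ _] := Hr _ (inb _ _ qt st).
  by split; [exact: smooth_diff sh _|apply: smooth_diff Uy; exact: smooth_D].
have EE : F (s2 *: v + (q2 *: u + x)) = G (s1 *: u + (q1 *: v + x)).
  have : t * (t * G (s1 *: u + (q1 *: v + x))) = t * (t * F (s2 *: v + (q2 *: u + x))).
    rewrite -[LHS]E1 -[RHS]E2 [t *: u + (t *: v + x)]addrCA.
    have sw (a b c d : R) : a - b - (c - d) = a - c - (b - d) by ring.
    exact: sw.
  have tn0 := lt0r_neq0 t0.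
  by move=> H; apply: esym; exact: (mulfI tn0 (mulfI tn0 H)).
have [_ _ G1] := Hr _ (inb _ _ s1t q1t).
have [_ F2 _] := Hr _ (inb _ _ q2t s2t).
rewrite addrCA EE in F2.
suff : e < e by rewrite ltxx.
rewrite {1}/e -(subrKA (G (s1 *: u + (q1 *: v + x)))).
apply: le_lt_trans (ler_normD _ _) _.
rewrite [ltRHS](@splitr R e); apply: ltrD; first exact: F2.
by rewrite distrC; exact: G1.
Qed.

Lemma derive_symm V n (U : set V) (h : V -> 'rV[R]_n) (x u v : V) : open U ->
  smooth_on U h -> U x -> 'D_u ('D_v h) x = 'D_v ('D_u h) x.
Proof.
move=> oU sh Ux; apply/rowP => i.
have D w w' : 'D_w ('D_w' h) x 0 i = 'D_w ('D_w' (fun x => h x 0 i)) x.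
  rewrite -derive_coef; last by apply: smooth_diff Ux; exact: smooth_D.
  apply: near_eq_derive; apply: open_near oU Ux _ => y Uy.
  by rewrite -derive_coef //; exact: smooth_diff sh Uy.
have S := derive_symm_scalar u v oU (smooth_coef i oU sh) Ux.
exact: (etrans (D u v) (etrans S (esym (D v u)))).
Qed.

End MeanValue.

(** * Subspaces that contain their derivatives are constant *)

Section ConstantSpan.
Context {R : realType} {V : normedModType R}.

(** Taken entrywise, so that products, determinants and adjugates reduce to scalar functions. *)
Definition mxdiff m n (F : V -> 'M[R]_(m, n)) (x : V) : Prop :=
  forall i j, differentiable (fun y => F y i j) x.

Definition mxD m n (v : V) (F : V -> 'M[R]_(m, n)) (x : V) : 'M[R]_(m, n) :=
  \matrix_(i, j) 'D_v (fun y => F y i j) x.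

Lemma mxdiff_cst m n (A : 'M[R]_(m, n)) x : mxdiff (fun=> A) x.
Proof. by move=> i j; exact: differentiable_cst. Qed.

Lemma mxdiffM m n p (F : V -> 'M[R]_(m, n)) (G : V -> 'M[R]_(n, p)) x :
  mxdiff F x -> mxdiff G x -> mxdiff (fun y => F y *m G y) x.
Proof.
move=> dF dG i j; under eq_fun do rewrite mxE.
by apply: differentiable_bigsum => k; exact: differentiableM.
Qed.

Lemma mxDM m n p (F : V -> 'M[R]_(m, n)) (G : V -> 'M[R]_(n, p)) v x :
  mxdiff F x -> mxdiff G x ->
  mxD v (fun y => F y *m G y) x = mxD v F x *m G x + F x *m mxD v G x.
Proof.
move=> dF dG; apply/matrixP => i j; rewrite !mxE.
under eq_fun do rewrite mxE.
rewrite derive_bigsum; last by move=> k; exact: differentiableM.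
rewrite -big_split /=; apply: eq_bigr => k _; rewrite !mxE.
rewrite (@derive_scale _ _ R (fun y => F y i k) (fun y => G y k j)) //.
by rewrite addrC.
Qed.

Lemma differentiable_det n (F : V -> 'M[R]_n) x :
  mxdiff F x -> differentiable (fun y => \det (F y)) x.
Proof.
move=> dF; apply: differentiable_bigsum => s.
apply: (@differentiable_scale _ _ R (fun=> _)) => //.
by apply: differentiable_bigprod => i; exact: dF.
Qed.

(** The inverse is written by Cramer's formula, which makes each entry a quotient of polynomials in
    the entries of [F]. *)
Lemma mxdiff_inv n (F : V -> 'M[R]_n) x :
  mxdiff F x -> \det (F x) != 0 ->
  mxdiff (fun y => (\det (F y))^-1 *: \adj (F y)) x.
Proof.
move=> dF dn0 i j; under eq_fun do rewrite !mxE.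
apply: differentiableM; first by apply: differentiableV => //; exact: differentiable_det.
rewrite /cofactor; apply: differentiableM; first exact: differentiable_cst.
by apply: differentiable_det => k l; under eq_fun do rewrite !mxE.
Qed.

(* With [Y x0 *m B = 1], the matrix [Q := (Y B)^-1 Y] has the same row space as
   [Y] near [x0] and satisfies [Q B = 1]; its derivative lies in the row space of
   [Q], say [DQ = K Q], and then [K = DQ B = D(Q B) = 0]: [Q] is constant. *)
Lemma span_near_const n N (Y : V -> 'M[R]_(n, N)) (U : set V) (x0 : V) :
  open U -> U x0 -> (forall x, U x -> mxdiff Y x) ->
  (forall x v, U x -> (mxD v Y x <= Y x)%MS) -> row_free (Y x0) ->
  \forall x \near x0, (Y x0 <= Y x)%MS.
Proof.
move=> oU Ux0 dY DY /row_freeP[B YB].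
pose M x := Y x *m B; pose d x := \det (M x).
pose Q x := ((d x)^-1 *: \adj (M x)) *m Y x.
have dM x : U x -> mxdiff M x.
  by move=> Ux; apply: mxdiffM; [exact: dY|exact: mxdiff_cst].
have d0 : d x0 = 1 by rewrite /d /M YB det1.
have [r r0 Hr] : exists2 r : R, 0 < r & forall y, ball x0 r y -> U y /\ d y != 0.
  have cd : {for x0, continuous d}.
    by apply: differentiable_continuous; apply: differentiable_det; exact: dM.
  (* Tolerance 1 suffices: [d x0 = 1], so [d] cannot vanish at distance less than 1 from it. *)
  have [r r0 H] := continuous_ball2 oU Ux0 cd cd ltr01.
  exists r => // y /H[Uy dy _]; split => //; apply: contraTneq dy => ->.
  by rewrite d0 subr0 normr1 ltxx.
have QB x : d x != 0 -> Q x *m B = 1%:M.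
  move=> dn0; rewrite /Q -mulmxA -scalemxAl mul_adj_mx -/(d x).
  by rewrite scale_scalar_mx mulVf.
have YQ x : d x != 0 -> M x *m Q x = Y x.
  move=> dn0; rewrite /Q mulmxA -scalemxAr mul_mx_adj -/(d x).
  by rewrite scale_scalar_mx mulVf // mul1mx.
have dP x : U x -> d x != 0 -> mxdiff (fun y => (d y)^-1 *: \adj (M y)) x.
  by move=> Ux dn0; apply: mxdiff_inv => //; exact: dM.
have dQ x : U x -> d x != 0 -> mxdiff Q x.
  by move=> Ux dn0; apply: mxdiffM; [exact: dP|exact: dY].
have DQ0 x v : ball x0 r x -> mxD v Q x = 0.
  move=> bx; have [Ux dn0] := Hr _ bx.
  have /submxP[K EK] : (mxD v Q x <= Q x)%MS.
    (* In the Leibniz rule one term is a multiple of [Y x], the other of its derivative; both have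
       their rows in the row space of [Y x], hence in that of [Q x]. *)
    have YQs : (Y x <= Q x)%MS by rewrite -{1}(YQ x dn0) submxMl.
    rewrite /Q mxDM; [|exact: dP|exact: dY].
    rewrite addmx_sub //; first exact: submx_trans (submxMl _ _) YQs.
    by rewrite (submx_trans (submxMl _ _)) // (submx_trans (DY _ _ Ux)).
  have : mxD v (fun y => Q y *m B) x = 0.
    apply/matrixP => i j; rewrite [LHS]mxE [RHS]mxE.
    have E y : ball x0 r y -> (Q y *m B) i j = (1%:M : 'M[R]_n) i j.
      by case/Hr=> _ yn0; rewrite QB.
    by rewrite (near_eq_derive v (open_near (ball_open x0 r) bx E)) derive_cst.
  rewrite mxDM; [|exact: dQ|exact: mxdiff_cst].
  have -> : mxD v (fun=> B) x = 0.
    by apply/matrixP => i j; rewrite !mxE derive_cst.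
  by rewrite mulmx0 addr0 EK -mulmxA QB // mulmx1 => ->; rewrite mul0mx.
apply: (open_near (ball_open x0 r) (ballxx x0 r0)) => x bx.
have QE : Q x = Q x0.
  apply/matrixP => i j; apply: (@derive_eq0_const _ _ (fun y => Q y i j)) => s s01.
  have bs := ball_segment bx s01; have [Us ds] := Hr _ bs.
  split; first exact: dQ.
  by have := DQ0 _ (x - x0) bs; move/matrixP => /(_ i j); rewrite !mxE.
have -> : Y x0 = Q x0.
  by rewrite -{1}(YQ x0) ?d0 ?oner_eq0 // /M YB mul1mx.
by rewrite -QE /Q submxMl.
Qed.

End ConstantSpan.

(** * Geometry of the scalar product *)

Section Dot.
Context {R : realType} (eps : R).
Implicit Types n : nat.

Definition sgn n (i : 'I_n) : R := if val i == 0%N then eps else 1.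

Lemma dotC n (x y : 'rV[R]_n) : dot eps x y = dot eps y x.
Proof. by apply: eq_bigr => i _; rewrite [x 0 i * _]mulrC. Qed.

Lemma dotDl n (x y z : 'rV[R]_n) : dot eps (x + y) z = dot eps x z + dot eps y z.
Proof. by rewrite -big_split; apply: eq_bigr => i _ /=; rewrite mxE; ring. Qed.

Lemma dotZl n a (x z : 'rV[R]_n) : dot eps (a *: x) z = a * dot eps x z.
Proof. by rewrite mulr_sumr; apply: eq_bigr => i _ /=; rewrite mxE; ring. Qed.

Lemma dotDr n (x y z : 'rV[R]_n) : dot eps z (x + y) = dot eps z x + dot eps z y.
Proof. by rewrite !(dotC z) dotDl. Qed.

Lemma dotZr n a (x z : 'rV[R]_n) : dot eps z (a *: x) = a * dot eps z x.
Proof. by rewrite !(dotC z) dotZl. Qed.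

Lemma dotNl n (x z : 'rV[R]_n) : dot eps (- x) z = - dot eps x z.
Proof. by rewrite -scaleN1r dotZl mulN1r. Qed.

Lemma dotNr n (x z : 'rV[R]_n) : dot eps z (- x) = - dot eps z x.
Proof. by rewrite !(dotC z) dotNl. Qed.

Lemma dot0l n (z : 'rV[R]_n) : dot eps 0 z = 0.
Proof. by rewrite -(scale0r z) dotZl mul0r. Qed.

Lemma dot0r n (z : 'rV[R]_n) : dot eps z 0 = 0.
Proof. by rewrite dotC dot0l. Qed.

Definition dotE := (dotDl, dotDr, dotNl, dotNr, dotZl, dotZr, dot0l, dot0r).

Lemma dot_suml n (I : Type) (r : seq I) (F : I -> 'rV[R]_n) z :
  dot eps (\sum_(i <- r) F i) z = \sum_(i <- r) dot eps (F i) z.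
Proof.
by elim: r => [|i r IH]; rewrite ?big_nil ?dot0l // !big_cons dotDl IH.
Qed.

Lemma dot_sumr n (I : Type) (r : seq I) (F : I -> 'rV[R]_n) z :
  dot eps z (\sum_(i <- r) F i) = \sum_(i <- r) dot eps z (F i).
Proof. by rewrite dotC dot_suml; apply: eq_bigr => i _; rewrite dotC. Qed.

Lemma dot_delta n (x : 'rV[R]_n) i : dot eps x (delta_mx 0 i) = sgn i * x 0 i.
Proof.
rewrite /dot (bigD1 i) //= big1 => [|j ji]; last first.
  by rewrite mxE (negbTE ji) andbF !mulr0.
by rewrite mxE !eqxx mulr1 addr0.
Qed.

Lemma dot_recl n (x y : 'rV[R]_n.+1) :
  dot eps x y = eps * (x 0 0 * y 0 0)
    + \sum_(i < n) x 0 (lift 0 i) * y 0 (lift 0 i).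
Proof.
rewrite /dot big_ord_recl /=; congr (_ + _).
by apply: eq_bigr => i _; rewrite mul1r.
Qed.

Hypothesis heps : eps = 1 \/ eps = -1.

Lemma eps2 : eps * eps = 1.
Proof. by case: heps => ->; rewrite ?mulr1 // mulrNN mulr1. Qed.

Lemma eps_neq0 : eps != 0.
Proof. by case: heps => ->; rewrite ?oppr_eq0 oner_eq0. Qed.

Lemma sgn2 n (i : 'I_n) : sgn i * sgn i = 1.
Proof. by rewrite /sgn; case: ifP; rewrite ?eps2 ?mulr1. Qed.

Lemma sgn_neq0 n (i : 'I_n) : sgn i != 0.
Proof. by rewrite /sgn; case: ifP; rewrite ?eps_neq0 ?oner_eq0. Qed.

Lemma dot_nondegenerate n (x : 'rV[R]_n) : (forall y, dot eps x y = 0) -> x = 0.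
Proof.
move=> x0; apply/rowP => i; rewrite mxE.
have /eqP := x0 (delta_mx 0 i).
by rewrite dot_delta mulf_eq0 (negbTE (sgn_neq0 i)) /= => /eqP.
Qed.

(** The nonnegative sum of the squares of [A * b i - C * a i] expands to [A * (A * B - C ^+ 2)]. *)
Lemma cauchy_schwarz (I : finType) (a b : I -> R) :
  (\sum_i a i * b i) ^+ 2 <= (\sum_i a i ^+ 2) * (\sum_i b i ^+ 2).
Proof.
set A := \sum_i a i ^+ 2; set B := \sum_i b i ^+ 2; set C := \sum_i a i * b i.
have A0 : 0 <= A by apply: sumr_ge0 => i _; exact: sqr_ge0.
have [AE|An0] := eqVneq A 0.
  rewrite /C big1 ?expr0n ?AE ?mul0r // => i _.
  have /eqP := AE; rewrite psumr_eq0; last by move=> j _; exact: sqr_ge0.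
  by move=> /allP /(_ i (mem_index_enum i)) /=; rewrite sqrf_eq0 => /eqP ->; rewrite mul0r.
have Ap : 0 < A by rewrite lt_def An0.
have : 0 <= \sum_i (A * b i - C * a i) ^+ 2 by apply: sumr_ge0 => i _; exact: sqr_ge0.
have -> : \sum_i (A * b i - C * a i) ^+ 2 = A * (A * B - C ^+ 2).
  transitivity (A ^+ 2 * B - (2 * A * C) * C + C ^+ 2 * A); last by ring.
  have EB : A ^+ 2 * B = \sum_i A ^+ 2 * b i ^+ 2 by rewrite mulr_sumr.
  have EC : 2 * A * C * C = \sum_i 2 * A * C * (a i * b i) by rewrite -mulr_sumr.
  have EA : C ^+ 2 * A = \sum_i C ^+ 2 * a i ^+ 2 by rewrite -mulr_sumr.
  rewrite EB EC EA -sumrB -big_split /=.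
  by apply: eq_bigr => i _; ring.
by rewrite pmulr_rge0 // subr_ge0.
Qed.

Lemma Q_gt0 n (x : 'rV[R]_n) : Q eps n x -> (0 < n)%N.
Proof.
case: n x => // x [/eqP]; rewrite /dot big_ord0 eq_sym.
by rewrite (negbTE eps_neq0).
Qed.

(** For [eps = -1], let [a] and [b] be the squared lengths of the space parts of [w] and [x].
    Orthogonality makes the time product equal to [c], and [c ^+ 2 <= a * b], while the time part of
    [x] has square [b + 1]. If [a] is positive, the time part of [w] thus has square below [a]; if
    [a = 0], orthogonality kills the time part as well. *)
Lemma spacelike n (x w : 'rV[R]_n) : dot eps x x = eps -> dot eps w x = 0 ->
  w != 0 -> 0 < dot eps w w.
Proof.
move=> xx wx wn0; case: heps => e.
  have -> : dot eps w w = \sum_i w 0 i ^+ 2.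
    by apply: eq_bigr => i _; rewrite e if_same mul1r expr2.
  rewrite lt_def sumr_ge0 ?andbT => [|i _]; last exact: sqr_ge0.
  apply: contra wn0; rewrite psumr_eq0 => [|i _]; last exact: sqr_ge0.
  move=> /allP H; apply/eqP/rowP => i; rewrite mxE; apply/eqP.
  by have := H i (mem_index_enum i); rewrite /= sqrf_eq0.
case: n x w xx wx wn0 => [|n] x w.
  by move=> _ _ /eqP[]; apply/rowP => -[].
rewrite !dot_recl e.
set a := \sum_(i < n) w 0 _ * w 0 _; set b := \sum_(i < n) x 0 _ * x 0 _.
set c := \sum_(i < n) w 0 _ * x 0 _ => xx wx wn0.
have cs : c ^+ 2 <= a * b.
  exact: (cauchy_schwarz (fun i : 'I_n => w 0 (lift 0 i)) (fun i => x 0 (lift 0 i))).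
have a0 : 0 <= a by apply: sumr_ge0 => i _; rewrite -expr2 sqr_ge0.
have b0 : 0 <= b by apply: sumr_ge0 => i _; rewrite -expr2 sqr_ge0.
have x00 : 0 < x 0 0 ^+ 2 by nra.
have [aE|an0] := eqVneq a 0; last first.
  have ap : 0 < a by rewrite lt_def an0.
  have : 0 < x 0 0 ^+ 2 * (-1 * (w 0 0 * w 0 0) + a) by nra.
  by rewrite pmulr_rgt0.
case/eqP: wn0; have w0 (i : 'I_n) : w 0 (lift 0 i) = 0.
  move/eqP: aE; rewrite psumr_eq0; last by move=> j _; rewrite -expr2 sqr_ge0.
  by move=> /allP /(_ i (mem_index_enum i)) /=; rewrite mulf_eq0 orbb => /eqP.
have c0 : c = 0 by rewrite /c big1 // => i _; rewrite w0 mul0r.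
have w00 : w 0 0 = 0.
  have : w 0 0 * x 0 0 = 0 by lra.
  move/eqP; rewrite mulf_eq0 => /orP[/eqP //|/eqP xE].
  by move: x00; rewrite xE expr0n ltxx.
apply/rowP => i; rewrite mxE; case: (unliftP 0 i) => [j ->|->]; first exact: w0.
exact: w00.
Qed.

(** The time parts dominate: [p ^+ 2 = (a + 1) * (b + 1)] exceeds [a * b], hence [c ^+ 2]. The sign
    of the product [c - p] is therefore that of [- p]. *)
Lemma timelike_dot n (x y : 'rV[R]_n.+1) : eps = -1 ->
  dot eps x x = eps -> dot eps y y = eps ->
  (dot eps x y < 0) = (0 < x 0 0 * y 0 0).
Proof.
rewrite !dot_recl => ->.
set a := \sum_(i < n) x 0 _ * x 0 _; set b := \sum_(i < n) y 0 _ * y 0 _.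
set c := \sum_(i < n) x 0 _ * y 0 _ => xx yy.
have cs : c ^+ 2 <= a * b.
  exact: (cauchy_schwarz (fun i : 'I_n => x 0 (lift 0 i)) (fun i => y 0 (lift 0 i))).
have a0 : 0 <= a by apply: sumr_ge0 => i _; rewrite -expr2 sqr_ge0.
have b0 : 0 <= b by apply: sumr_ge0 => i _; rewrite -expr2 sqr_ge0.
set p := x 0 0 * y 0 0.
have pp : p ^+ 2 = (a + 1) * (b + 1).
  have -> : p ^+ 2 = (x 0 0 * x 0 0) * (y 0 0 * y 0 0) by rewrite /p; ring.
  by congr (_ * _); lra.
have cp : c ^+ 2 < p ^+ 2 by rewrite pp; nra.
rewrite mulN1r; apply/idP/idP => H.
  by rewrite ltNge; apply/negP => p0; nra.
by nra.
Qed.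

Lemma Q_dot_lt0 n (x y : 'rV[R]_n) : eps = -1 -> Q eps n x -> Q eps n y ->
  dot eps x y < 0.
Proof.
move=> e Qx Qy; have := Q_gt0 Qx; case: n x y Qx Qy => // n x y [xx x0] [yy y0] _.
by rewrite timelike_dot // mulr_gt0 // ?x0 ?y0.
Qed.

(** The sheet of the hyperboloid is detected by the product with one known point of it, a test that
    linear isometries transport. *)
Lemma Q_timelike n (x y : 'rV[R]_n) : Q eps n x -> dot eps y y = eps ->
  (eps = -1 -> dot eps x y < 0) -> Q eps n y.
Proof.
move=> Qx yy xy; split=> // e i i0.
case: n x y i i0 Qx yy xy => [|n] x y i i0; first by case: i i0.
have -> : i = 0 by apply: val_inj.
case=> xx x0 yy /(_ e); rewrite timelike_dot // pmulr_rgt0 //; exact: x0.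
Qed.

(** * Orthogonal projection onto a subspace without null vectors *)

Section Projection.
Context {n : nat} (T : set 'rV[R]_n).
Hypothesis T0 : T 0.

(** The default value 0 of [xget] lies in [T], so this holds even where no orthogonal projection
    exists. *)
Lemma proj_in w : T (proj eps T w).
Proof. by rewrite /proj; case: xgetP => // t _ []. Qed.

Lemma nproj_dot w xi : (forall t, T t -> dot eps xi t = 0) ->
  dot eps (nproj eps T w) xi = dot eps w xi.
Proof.
move=> xiT; rewrite /nproj dotDl dotNl dotC [X in _ - X]dotC.
by rewrite (xiT _ (proj_in w)) subr0 dotC.
Qed.

Hypothesis TB : forall s t, T s -> T t -> T (s - t).
Hypothesis Tpos : forall t, T t -> dot eps t t = 0 -> t = 0.

(** Two candidates differ by a vector of [T] orthogonal to [T], hence null, hence zero by [Tpos]. *)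
Lemma proj_eq w t : T t -> (forall t', T t' -> dot eps (w - t) t' = 0) ->
  proj eps T w = t.
Proof.
move=> Tt wt; apply: xget_unique; first by split.
move=> s [Ts ws]; apply/eqP; rewrite -subr_eq0; apply/eqP/Tpos; first exact: TB.
have Tst := TB Ts Tt.
have {1}-> : s - t = (w - t) - (w - s) by rewrite opprB [RHS]addrC addrA subrK.
by rewrite dotDl dotNl wt // ws // subrr.
Qed.

Lemma nproj_tangent w : T w -> nproj eps T w = 0.
Proof.
move=> Tw; rewrite /nproj (proj_eq Tw) ?subrr // => t _.
exact: dot0l.
Qed.

Lemma nproj_add w t : T t -> (forall t', T t' -> dot eps w t' = 0) ->
  nproj eps T (w + t) = w.
Proof.
move=> Tt wT; rewrite /nproj (@proj_eq _ t) ?addrK //.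
Qed.

End Projection.

(** The position vector [x] spans the normal line, and its square [eps] is its own inverse, whence
    the coefficient. *)
Lemma proj_tangentQ n (x w : 'rV[R]_n) : dot eps x x = eps ->
  proj eps (tangentQ eps x) w = w - (eps * dot eps w x) *: x.
Proof.
move=> xx; apply: proj_eq.
- by rewrite /tangentQ /= => s t sx tx; rewrite !dotE sx tx subrr.
- move=> t tx tt; apply/eqP/negP => /negP t0.
  by have := spacelike xx tx t0; rewrite tt ltxx.
- by rewrite /tangentQ /= !dotE xx mulrAC eps2 mul1r subrr.
- by move=> t tx; rewrite opprB addrC subrK dotZl [dot _ x t]dotC tx mulr0.
Qed.

End Dot.

(** * Orthonormal families of vectors and of fields *)

Section Frames.
Context {R : realType} (eps : R) (heps : eps = 1 \/ eps = -1) {N : nat}.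

Definition orthonormal_family s (b : 'I_s -> 'rV[R]_N) : Prop :=
  forall i j, dot eps (b i) (b j) = sgn eps i *+ (i == j).

Lemma orthonormal_dot s (b : 'I_s -> 'rV[R]_N) (k : 'I_s -> R) j :
  orthonormal_family b -> dot eps (\sum_i k i *: b i) (b j) = k j * sgn eps j.
Proof.
move=> ob; rewrite dot_suml (bigD1 j) //= big1 => [|i ij].
  by rewrite dotZl ob eqxx mulr1n addr0.
by rewrite dotZl ob (negbTE ij) mulr0n mulr0.
Qed.

Lemma orthonormal_dot2 s (b : 'I_s -> 'rV[R]_N) (y z : 'rV[R]_s) :
  orthonormal_family b ->
  dot eps (\sum_i y 0 i *: b i) (\sum_i z 0 i *: b i) = dot eps y z.
Proof.
move=> ob; rewrite dot_sumr; apply: eq_bigr => j _.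
by rewrite dotZr orthonormal_dot // -/(sgn eps j); ring.
Qed.

Lemma orthonormal_coef s (b : 'I_s -> 'rV[R]_N) (k : 'I_s -> R) j :
  orthonormal_family b ->
  sgn eps j * dot eps (\sum_i k i *: b i) (b j) = k j.
Proof.
by move=> ob; rewrite orthonormal_dot // mulrCA sgn2 // mulr1.
Qed.

Lemma orthonormal_indep s (b : 'I_s -> 'rV[R]_N) (k : 'I_s -> R) :
  orthonormal_family b -> \sum_i k i *: b i = 0 -> forall j, k j = 0.
Proof.
move=> ob kb0 j.
by rewrite -(orthonormal_coef k j ob) kb0 dot0l mulr0.
Qed.

Lemma orthonormal_size s (b : 'I_s -> 'rV[R]_N) : orthonormal_family b -> (s <= N)%N.
Proof.
move=> ob; pose B : 'M[R]_(s, N) := \matrix_i b i.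
have /eqP <- : row_free B; last exact: rank_leq_col.
apply: inj_row_free => v vB; apply/rowP => j; rewrite mxE.
apply: (orthonormal_indep ob (k := fun i => v 0 i)).
rewrite -[RHS]vB mulmx_sum_row; apply: eq_bigr => i _.
by rewrite rowK.
Qed.

(** Gram-Schmidt for fields instead of vectors. Products of members of [S] do not depend on the
    point, so orthogonality and normalization at one point hold everywhere. The bound
    [orthonormal_size] makes a family of maximal size exist, and a nonzero remainder [r] of a
    projection would extend it. *)
Lemma parallel_frame (M : Type) (S : (M -> 'rV[R]_N) -> Prop)
    (b0 : M -> 'rV[R]_N) (p0 : M) :
  (forall a b c, S b -> S c -> S (fun p => a *: b p + c p)) ->
  (forall b c p q, S b -> S c -> dot eps (b p) (c p) = dot eps (b q) (c q)) ->
  S b0 -> (forall p, dot eps (b0 p) (b0 p) = eps) ->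
  exists s (b : 'I_s.+1 -> M -> 'rV[R]_N),
    [/\ b ord0 = b0, forall i, S (b i),
        forall p, orthonormal_family (b^~ p) &
        forall c p, S c -> c p = \sum_i (sgn eps i * dot eps (c p) (b i p)) *: b i p].
Proof.
move=> Slin Sdot Sb0 b00.
pose P s := exists b : 'I_s.+1 -> M -> 'rV[R]_N,
  [/\ b ord0 = b0, forall i, S (b i) & forall p, orthonormal_family (b^~ p)].
have P0 : exists s, `[< P s >].
  exists 0%N; apply/asboolP; exists (fun=> b0); split=> // p i j.
  by rewrite !ord1 eqxx b00.
have Pmax s : `[< P s >] -> (s <= N)%N.
  by move=> /asboolP[b [_ _ /(_ p0)/orthonormal_size/ltnW]].
case: (ex_maxnP P0 Pmax) => s /asboolP[b [bb0 Sb ob]] smax.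
exists s, b; split=> // c p Sc.
pose k i := sgn eps i * dot eps (c p) (b i p).
pose r q := c q - \sum_i k i *: b i q.
have Sr : S r.
  have : forall l : seq 'I_s.+1, S (fun q => c q - \sum_(i <- l) k i *: b i q).
    elim=> [|i l IH]; first by under eq_fun do rewrite big_nil subr0.
    have := Slin (- k i) (b i) _ (Sb i) IH.
    by congr S; apply/funext => q; rewrite big_cons scaleNr opprD addrCA.
  exact.
have rb q j : dot eps (r q) (b j q) = 0.
  rewrite (Sdot r (b j) q p Sr (Sb j)) /r dotDl dotNl orthonormal_dot //.
  by rewrite /k mulrAC sgn2 // mul1r subrr.
suff r0 : r p = 0 by apply/eqP; rewrite -subr_eq0 -/(r p) r0.
apply/eqP/negP => /negP rn0.
have rpos : 0 < dot eps (r p) (r p).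
  by apply: (spacelike heps (b00 p)) rn0; rewrite -bb0 rb.
(* The square of [r] is read at the single point [p]; being constant, it normalizes [r] at every
   point by one scalar. *)
set d := dot eps (r p) (r p) in rpos.
pose u q := (Num.sqrt d)^-1 *: r q.
have Su : S u.
  have := Slin (- 1) r _ Sr Sr; under eq_fun do rewrite scaleN1r addNr.
  by move=> S0; have := Slin (Num.sqrt d)^-1 r _ Sr S0; under eq_fun do rewrite addr0.
have uu q : dot eps (u q) (u q) = 1.
  rewrite /u dotZl dotZr (Sdot r r q p Sr Sr) -/d mulrA -invfM -expr2 sqr_sqrtr ?ltW //.
  by rewrite mulVf // gt_eqF.
have ub q j : dot eps (u q) (b j q) = 0 by rewrite /u dotZl rb mulr0.
suff : (s.+1 <= s)%N by rewrite ltnn.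
apply/smax/asboolP.
(* The new field takes the last index: [ord0] still carries [b0], the old indices keep their signs,
   and the new sign is 1, as a spacelike field requires. *)
pose b' (i : 'I_s.+2) := oapp b u (unlift ord_max i).
have b'l i : b' (lift ord_max i) = b i by rewrite /b' liftK.
have b'm : b' ord_max = u by rewrite /b' unlift_none.
have sl (i : 'I_s.+1) : sgn eps (lift ord_max i) = sgn eps i.
  by rewrite /sgn /= /bump leqNgt ltn_ord.
exists b'; split.
- by rewrite -bb0 -b'l; congr b'; apply: val_inj.
- move=> i; case: (unliftP ord_max i) => [j ->|->]; first by rewrite b'l.
  by rewrite b'm.
move=> q i j; case: (unliftP ord_max i) => [i' ->|->];
  case: (unliftP ord_max j) => [j' ->|->]; rewrite ?b'l ?b'm.
- by rewrite ob sl (inj_eq lift_inj).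
- by rewrite dotC ub eq_sym (negbTE (neq_lift _ _)).
- by rewrite ub (negbTE (neq_lift _ _)).
- by rewrite uu eqxx.
Qed.

End Frames.

(** * Charts *)

Section Charts.
Context {R : realType} {M : topologicalType} {V : normedModType R}.
Implicit Types (W : normedModType R) (c : chart M V) (A : set (chart M V)).

Lemma img_coord c p : dom c p -> img c (coord c p).
Proof. by move=> cp; exists p. Qed.

Lemma dom_param c x : is_chart c -> img c x -> dom c (param c x).
Proof. by case=> _ _ pc _ _ [p cp <-]; rewrite pc. Qed.

Lemma coordK c p : is_chart c -> dom c p -> param c (coord c p) = p.
Proof. by case=> _ _ pc _ _; exact: pc. Qed.

Lemma paramK c x : is_chart c -> img c x -> coord c (param c x) = x.
Proof. by case=> _ _ pc _ _ [p cp <-]; rewrite pc. Qed.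

Lemma open_img c : is_chart c -> open (img c).
Proof. by case. Qed.

Lemma open_coord_image c (U : set M) : is_chart c -> open U ->
  open (coord c @` (dom c `&` U)).
Proof.
move=> hc oU; rewrite openE => x [p [cp Up] <-].
have ix := img_coord cp.
have cpar : param c @ coord c p --> p.
  by case: (hc) => _ _ _ _ cP; rewrite -[X in _ --> X](coordK hc cp); exact: cP.
have nU : \forall x \near coord c p, U (param c x).
  by apply: cpar; exact: open_nbhs_nbhs.
have nI : \forall x \near coord c p, img c x.
  by apply: open_nbhs_nbhs; split => //; exact: open_img.
apply: filterS2 nU nI => y Uy iy; exists (param c y); last exact: paramK.
by split => //; exact: dom_param.
Qed.

Lemma near_coord c p (P : V -> Prop) : is_chart c -> dom c p ->
  (\forall x \near coord c p, P x) -> \forall q \near p, dom c q /\ P (coord c q).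
Proof.
move=> [oD _ _ cc _] cp nP.
have n1 : \forall q \near p, dom c q by exact: open_nbhs_nbhs.
have n2 : \forall q \near p, P (coord c q) by exact: (cc _ cp).
exact: filterI n1 n2.
Qed.

Lemma smooth_mapT A W (f : M -> W) : smooth_map_on A setT f <->
  forall c, A c -> smooth_on (img c) (f \o param c).
Proof. by rewrite /smooth_map_on /img; split=> H c /H; rewrite setIT. Qed.

Lemma smooth_mapU A W (U : set M) (f : M -> W) :
  smooth_map_on A setT f -> smooth_map_on A U f.
Proof.
move=> sf c Ac; apply: smooth_sub (sf c Ac).
by move=> x [p [cp _] <-]; exists p.
Qed.

Lemma pd_param c W (f : M -> W) u x : is_chart c -> img c x ->
  pd c f u (param c x) = 'D_u (f \o param c) x.
Proof. by move=> hc ix; rewrite /pd paramK. Qed.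

Lemma smooth_pd A c W (U : set M) (f : M -> W) u : is_chart c -> A c -> open U ->
  smooth_map_on A U f -> smooth_on (coord c @` (dom c `&` U)) (pd c f u \o param c).
Proof.
move=> hc Ac oU sf; apply: (smooth_eq (open_coord_image hc oU) _ (smooth_D u (sf c Ac))).
by move=> x [p [cp _] <-]; rewrite /= pd_param //; exact: img_coord.
Qed.

Lemma pd_near c W (U : set M) (f f' : M -> W) u p : is_chart c -> open U -> dom c p -> U p ->
  (forall q, dom c q -> U q -> f q = f' q) -> pd c f u p = pd c f' u p.
Proof.
move=> hc oU cp Up ff'; apply: near_eq_derive.
have Ip : (coord c @` (dom c `&` U)) (coord c p) by exists p.
apply: (open_near (open_coord_image hc oU) Ip) => x [q [cq Uq] <-] /=.
by rewrite coordK // ff'.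
Qed.

Lemma pd_linear c W (f : M -> W) p a u v :
  differentiable (f \o param c) (coord c p) ->
  pd c f (a *: u + v) p = a *: pd c f u p + pd c f v p.
Proof. by move=> df; rewrite /pd !deriveE // linearP. Qed.

Lemma smooth_diff_param A c W (U : set M) (f : M -> W) p :
  A c -> dom c p -> U p -> smooth_map_on A U f ->
  differentiable (f \o param c) (coord c p).
Proof. by move=> Ac cp Up sf; apply: smooth_diff (sf c Ac) _; exists p. Qed.

Lemma pd0 c W (f : M -> W) p : pd c f 0 p = 0.
Proof. exact: derive0. Qed.

Lemma pd_cst c W (w : W) u p : pd c (fun=> w) u p = 0.
Proof. exact: derive_cst. Qed.

(** The fibres of [g] and their complements are open. The target is a bare type, so that [g] can
    take tangent spaces as values. *)
Lemma locally_constant (T : Type) (g : M -> T) : connected [set: M] ->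
  (forall p, \forall q \near p, g q = g p) -> forall p q, g p = g q.
Proof.
move=> cM lg p q; pose B := [set r | g r = g p].
have oB : open B.
  rewrite openE => r gr; rewrite /interior.
  by apply: filterS (lg r) => z gz; rewrite /B /= gz.
have oC : open (~` B).
  rewrite openE => r /= gr; rewrite /interior.
  by apply: filterS (lg r) => z /= gz; rewrite /B /= gz.
have BT : B = setT.
  apply: cM; first by exists p.
    by exists B => //; rewrite setTI.
  by exists B; rewrite ?setTI // -openC.
by have : B q by rewrite BT.
Qed.

(** A ball inside the chart image is convex, so the mean value argument runs along segments in
    coordinates. *)
Lemma pd_eq0_near c (g : M -> R) p : is_chart c -> dom c p ->
  smooth_on (img c) (g \o param c) ->
  (forall u q, dom c q -> pd c g u q = 0) -> \forall q \near p, g q = g p.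
Proof.
move=> hc cp sg g0.
have nI : nbhs (coord c p) (img c).
  by apply: open_nbhs_nbhs; split; [exact: open_img|exact: img_coord].
have [r /= r0 Hr] := (nbhs_ballP _ _).1 nI.
have Hn := near_coord hc cp (nbhsx_ballx (coord c p) r r0).
apply: filterS Hn => q [cq bq].
rewrite -(coordK hc cq) -(coordK hc cp).
apply: (@derive_eq0_const _ _ (g \o param c)) => s s01.
have si : img c (s *: (coord c q - coord c p) + coord c p).
  by apply: Hr; exact: ball_segment.
split; first exact: smooth_diff sg si.
by rewrite -pd_param //; apply: g0; exact: dom_param.
Qed.

End Charts.

(** * Product charts, slices and connectedness of the factors *)

Section ProductCharts.
Context {R : realType} {M0 M1 : topologicalType} {V0 V1 : normedModType R}.
Implicit Types W : normedModType R.

Lemma open_prod (T0 T1 : topologicalType) (B0 : set T0) (B1 : set T1) :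
  open B0 -> open B1 -> open (B0 `*` B1).
Proof.
move=> o0 o1; rewrite openE => -[x0 x1] [/= H0 H1].
by exists (B0, B1) => //; split; apply: open_nbhs_nbhs.
Qed.

Lemma img_prod (c0 : chart M0 V0) (c1 : chart M1 V1) : img (prod_chart c0 c1) = img c0 `*` img c1.
Proof.
apply/seteqP; split=> [_ [p [/= p0 p1] <-]|[x0 x1] /= [[p0 h0 <-] [p1 h1 <-]]].
  by split; [exists p.1|exists p.2].
by exists (p0, p1).
Qed.

Lemma is_chart_prod (c0 : chart M0 V0) (c1 : chart M1 V1) :
  is_chart c0 -> is_chart c1 -> is_chart (prod_chart c0 c1).
Proof.
move=> h0 h1; have [oD0 oI0 K0 cc0 cp0] := h0; have [oD1 oI1 K1 cc1 cp1] := h1.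
split.
- exact: open_prod.
- by rewrite img_prod; exact: open_prod.
- by move=> [p0 p1] [/= d0 d1]; rewrite K0 // K1.
- move=> [p0 p1] [/= d0 d1]; apply: cvg_pair.
    by apply: (@continuous_comp _ _ _ fst (coord c0)); [exact: cvg_fst|exact: cc0].
  by apply: (@continuous_comp _ _ _ snd (coord c1)); [exact: cvg_snd|exact: cc1].
- rewrite img_prod => -[x0 x1] [/= i0 i1]; apply: cvg_pair.
    by apply: (@continuous_comp _ _ _ fst (param c0)); [exact: cvg_fst|exact: cp0].
  by apply: (@continuous_comp _ _ _ snd (param c1)); [exact: cvg_snd|exact: cp1].
Qed.

Lemma pd_prod1 (c0 : chart M0 V0) (c1 : chart M1 V1) W
    (f : M0 * M1 -> W) u p0 p1 : is_chart c1 -> dom c1 p1 ->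
  pd (prod_chart c0 c1) f (u, 0) (p0, p1) = pd c0 (fun q => f (q, p1)) u p0.
Proof.
move=> h1 d1; rewrite /pd /=.
have -> : (fun q => f (q, p1)) \o param c0 =
    (f \o param (prod_chart c0 c1)) \o (fun x => (x, coord c1 p1)).
  by apply/funext => x /=; rewrite coordK.
rewrite (@derive_affine _ _ _ _ (f \o param (prod_chart c0 c1))
  (fun x => (x, coord c1 p1)) (coord c0 p0) u (u, 0)) // => t.
by congr pair; rewrite /= scaler0 add0r.
Qed.

Lemma pd_prod2 (c0 : chart M0 V0) (c1 : chart M1 V1) W
    (f : M0 * M1 -> W) u p0 p1 : is_chart c0 -> dom c0 p0 ->
  pd (prod_chart c0 c1) f (0, u) (p0, p1) = pd c1 (fun q => f (p0, q)) u p1.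
Proof.
move=> h0 d0; rewrite /pd /=.
have -> : (fun q => f (p0, q)) \o param c1 =
    (f \o param (prod_chart c0 c1)) \o (fun x => (coord c0 p0, x)).
  by apply/funext => x /=; rewrite coordK.
rewrite (@derive_affine _ _ _ _ (f \o param (prod_chart c0 c1))
  (fun x => (coord c0 p0, x)) (coord c1 p1) u (0, u)) // => t.
by congr pair; rewrite /= scaler0 add0r.
Qed.

(** These linear inclusions turn restriction to a slice into an affine substitution. *)
Definition inl_lin (x : V0) : V0 * V1 := (x, 0).
Definition inr_lin (x : V1) : V0 * V1 := (0, x).

Lemma inl_lin_linear : linear inl_lin.
Proof. by move=> a x y; congr pair; rewrite /= scaler0 addr0. Qed.
Lemma inr_lin_linear : linear inr_lin.
Proof. by move=> a x y; congr pair; rewrite /= scaler0 addr0. Qed.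

HB.instance Definition _ := GRing.isLinear.Build R V0 (V0 * V1)%type _ inl_lin inl_lin_linear.
HB.instance Definition _ := GRing.isLinear.Build R V1 (V0 * V1)%type _ inr_lin inr_lin_linear.

Lemma continuous_inl : continuous inl_lin.
Proof. by move=> x; apply: cvg_pair => //; exact: cvg_cst. Qed.
Lemma continuous_inr : continuous inr_lin.
Proof. by move=> x; apply: cvg_pair => //; exact: cvg_cst. Qed.

Lemma prod_atlas_chart (A0 : set (chart M0 V0)) (A1 : set (chart M1 V1))
    (c0 : chart M0 V0) (c1 : chart M1 V1) :
  A0 c0 -> A1 c1 -> prod_atlas A0 A1 (prod_chart c0 c1).
Proof. by move=> a0 a1; exists c0, c1. Qed.

Lemma smooth_slice2 (A0 : set (chart M0 V0)) (A1 : set (chart M1 V1)) W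
    (f : M0 * M1 -> W) p0 : smooth_atlas A0 ->
  smooth_map_on (prod_atlas A0 A1) setT f -> smooth_map_on A1 setT (fun q => f (p0, q)).
Proof.
move=> [hA0 cov0 _] /smooth_mapT sf; apply/smooth_mapT => c1 Ac1.
have [c0 Ac0 d0] := cov0 p0.
have S := sf _ (prod_atlas_chart Ac0 Ac1).
have := smooth_affine (coord c0 p0, 0) continuous_inr S.
have E (y : V1) : inr_lin y + (coord c0 p0, 0) = (coord c0 p0, y).
  by congr pair; rewrite /= ?add0r ?addr0.
rewrite (_ : (fun y => _) = ((fun q => f (p0, q)) \o param c1)); last first.
  by apply/funext => y; rewrite E /= coordK //; exact: hA0.
apply: smooth_sub => y iy /=; rewrite E img_prod; split => //=; exact: img_coord.
Qed.

Lemma smooth_slice1 (A0 : set (chart M0 V0)) (A1 : set (chart M1 V1)) W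
    (f : M0 * M1 -> W) p1 : smooth_atlas A1 ->
  smooth_map_on (prod_atlas A0 A1) setT f -> smooth_map_on A0 setT (fun q => f (q, p1)).
Proof.
move=> [hA1 cov1 _] /smooth_mapT sf; apply/smooth_mapT => c0 Ac0.
have [c1 Ac1 d1] := cov1 p1.
have S := sf _ (prod_atlas_chart Ac0 Ac1).
have := smooth_affine (0, coord c1 p1) continuous_inl S.
have E (y : V0) : inl_lin y + (0, coord c1 p1) = (y, coord c1 p1).
  by congr pair; rewrite /= ?add0r ?addr0.
rewrite (_ : (fun y => _) = ((fun q => f (q, p1)) \o param c0)); last first.
  by apply/funext => y; rewrite E /= coordK //; exact: hA1.
apply: smooth_sub => y iy /=; rewrite E img_prod; split => //=; exact: img_coord.
Qed.

Lemma smooth_fst W (U0 : set V0) (U1 : set V1) (h : V0 -> W) :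
  smooth_on U0 h -> smooth_on (U0 `*` U1) (fun x : V0 * V1 => h x.1).
Proof.
move=> sh; have cf : continuous (fst : V0 * V1 -> V0) by move=> x; exact: cvg_fst.
have := @smooth_affine _ _ _ _ U0 h (fst : {linear (V0 * V1)%type -> V0}) 0 cf sh.
have -> : (fun x : V0 * V1 => h (x.1 + 0)) = (fun x => h x.1).
  by apply/funext => x; rewrite addr0.
by apply: smooth_sub => x [x0 _] /=; rewrite addr0.
Qed.

Lemma smooth_snd W (U0 : set V0) (U1 : set V1) (h : V1 -> W) :
  smooth_on U1 h -> smooth_on (U0 `*` U1) (fun x : V0 * V1 => h x.2).
Proof.
move=> sh; have cf : continuous (snd : V0 * V1 -> V1) by move=> x; exact: cvg_snd.
have := @smooth_affine _ _ _ _ U1 h (snd : {linear (V0 * V1)%type -> V1}) 0 cf sh.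
have -> : (fun x : V0 * V1 => h (x.2 + 0)) = (fun x => h x.2).
  by apply/funext => x; rewrite addr0.
by apply: smooth_sub => x [_ x1] /=; rewrite addr0.
Qed.

Lemma connected_fst : connected [set: (M0 * M1)%type] -> [set: M1] !=set0 ->
  connected [set: M0].
Proof.
move=> cM [p1 _]; rewrite (_ : [set: M0] = [set p.1 | p in [set: (M0 * M1)%type]]).
  apply: connected_continuous_connected => //.
  by apply: continuous_subspaceT => x; exact: cvg_fst.
by apply/seteqP; split=> // p0 _; exists (p0, p1).
Qed.

Lemma connected_snd : connected [set: (M0 * M1)%type] -> [set: M0] !=set0 ->
  connected [set: M1].
Proof.
move=> cM [p0 _]; rewrite (_ : [set: M1] = [set p.2 | p in [set: (M0 * M1)%type]]).
  apply: connected_continuous_connected => //.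
  by apply: continuous_subspaceT => x; exact: cvg_snd.
by apply/seteqP; split=> // p1 _; exists (p0, p1).
Qed.

End ProductCharts.

(** * Immersions into the quadric *)

Section Immersions.
Context {R : realType} (eps : R) (heps : eps = 1 \/ eps = -1) {N : nat}.
Context {M : topologicalType} {V : normedModType R}.
Implicit Types (c : chart M V) (A : set (chart M V)).

Lemma pd_dot c (a b : M -> 'rV[R]_N) u p :
  differentiable (a \o param c) (coord c p) ->
  differentiable (b \o param c) (coord c p) ->
  pd c (fun q => dot eps (a q) (b q)) u p
  = dot eps (pd c a u p) (b (param c (coord c p)))
    + dot eps (a (param c (coord c p))) (pd c b u p).
Proof. by move=> da db; exact: derive_dot. Qed.

Lemma pd_comb s c (a : M -> 'rV[R]_s) (w : 'I_s -> 'rV[R]_N) u p :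
  differentiable (a \o param c) (coord c p) ->
  pd c (fun q => \sum_i a q 0 i *: w i) u p = \sum_i pd c a u p 0 i *: w i.
Proof.
move=> da; rewrite /pd.
have dai i : differentiable (fun x => (a \o param c) x 0 i) (coord c p).
  exact: differentiable_coef.
rewrite (@derive_bigsum _ _ _ _ _ (fun i x => (a \o param c) x 0 i *: w i)).
  apply: eq_bigr => i _; rewrite derive_scale //.
  by rewrite derive_cst scaler0 add0r derive_coef.
by move=> i; apply: differentiable_scale => //; exact: differentiable_cst.
Qed.

Lemma pd_comb_cst s c (k : 'I_s -> R) (b : 'I_s -> M -> 'rV[R]_N) u p :
  (forall i, differentiable (b i \o param c) (coord c p)) ->
  pd c (fun q => \sum_i k i *: b i q) u p = \sum_i k i *: pd c (b i) u p.
Proof.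
move=> db; rewrite /pd.
rewrite (@derive_bigsum _ _ _ _ _ (fun i x => k i *: (b i \o param c) x)).
  apply: eq_bigr => i _.
  rewrite (@derive_scale _ _ _ (fun=> k i) (b i \o param c)) //.
  by rewrite derive_cst scale0r addr0.
move=> i; apply: (@differentiable_scale _ _ _ (fun=> k i)) => //.
Qed.

Section InQuadric.
Context {A : set (chart M V)} {f : M -> 'rV[R]_N}.
Hypothesis hA : forall c, A c -> is_chart c.
Hypothesis fimm : immersion A f.
Hypothesis ff : forall p, dot eps (f p) (f p) = eps.

Lemma immersion_diff c p : A c -> dom c p ->
  differentiable (f \o param c) (coord c p).
Proof. by move=> Ac cp; exact: (smooth_diff_param Ac cp I fimm.1). Qed.

Lemma immersion_pd_diff c p u : A c -> dom c p ->
  differentiable (pd c f u \o param c) (coord c p).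
Proof.
move=> Ac cp; have := smooth_pd u (hA Ac) Ac openT fimm.1.
by move=> /smooth_diff; apply; exists p.
Qed.

Lemma pd_immersionP c p a u v : A c -> dom c p ->
  pd c f (a *: u + v) p = a *: pd c f u p + pd c f v p.
Proof. by move=> Ac cp; apply: pd_linear; exact: immersion_diff. Qed.

Lemma pd_immersionD c p u v : A c -> dom c p ->
  pd c f (u + v) p = pd c f u p + pd c f v p.
Proof. by move=> Ac cp; have := pd_immersionP 1 u v Ac cp; rewrite !scale1r. Qed.

Lemma pd_immersionZ c p a u : A c -> dom c p -> pd c f (a *: u) p = a *: pd c f u p.
Proof.
by move=> Ac cp; have := pd_immersionP a u 0 Ac cp; rewrite !addr0 pd0 addr0.
Qed.

Lemma pd_immersionN c p u : A c -> dom c p -> pd c f (- u) p = - pd c f u p.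
Proof. by move=> Ac cp; rewrite -scaleN1r pd_immersionZ // scaleN1r. Qed.

Lemma pd_immersion_eq0 c p u : A c -> dom c p -> pd c f u p = 0 -> u = 0.
Proof. by move=> Ac cp u0; apply: (fimm.2 c p Ac cp); rewrite u0 pd0. Qed.

Lemma tangent0 c p : tangent f c p 0.
Proof. by exists 0 => //; rewrite pd0. Qed.

Lemma tangentB c p s t : A c -> dom c p ->
  tangent f c p s -> tangent f c p t -> tangent f c p (s - t).
Proof.
by move=> Ac cp [u _ <-] [v _ <-]; exists (u - v) => //; rewrite pd_immersionD ?pd_immersionN.
Qed.

(** This is half the derivative of the constant [dot eps (f q) (f q)]. *)
Lemma tangent_orth c p t : A c -> dom c p -> tangent f c p t -> dot eps t (f p) = 0.
Proof.
move=> Ac cp [u _ <-]; have d := immersion_diff Ac cp.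
have := pd_dot u d d; rewrite (coordK (hA Ac) cp).
under eq_fun do rewrite ff.
rewrite pd_cst [dot eps (f p) _]dotC; lra.
Qed.

Lemma tangent_pos c p t : A c -> dom c p -> tangent f c p t ->
  t != 0 -> 0 < dot eps t t.
Proof. by move=> Ac cp Tt; apply: spacelike (ff p) _ => //; exact: tangent_orth Tt. Qed.

Lemma tangent_eq0 c p t : A c -> dom c p -> tangent f c p t ->
  dot eps t t = 0 -> t = 0.
Proof.
move=> Ac cp Tt tt; apply/eqP/negP => /negP t0.
by have := tangent_pos Ac cp Tt t0; rewrite tt ltxx.
Qed.

Lemma nproj_tangent_eq0 c p w : A c -> dom c p -> tangent f c p w ->
  nproj eps (tangent f c p) w = 0.
Proof.
move=> Ac cp Tw; apply: nproj_tangent => //.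
- by move=> s t; exact: tangentB.
- by move=> t; exact: tangent_eq0.
Qed.

Lemma nproj_normal_add c p w t : A c -> dom c p -> tangent f c p t ->
  normal_space eps f c p w -> nproj eps (tangent f c p) (w + t) = w.
Proof.
move=> Ac cp Tt nw; apply: nproj_add => //.
- by move=> s s'; exact: tangentB.
- by move=> s; exact: tangent_eq0.
Qed.

(* Differentiating [dot (D_v f) b = 0] turns the shape operator of [b p] into the
   tangential derivative of [b]. *)
Lemma shape_op_eq c p (b : M -> 'rV[R]_N) u w : A c -> dom c p ->
  smooth_map_on A setT b ->
  (forall q, dom c q -> normal_space eps f c q (b q)) ->
  pd c b u p = - pd c f w p -> shape_op eps f c p (b p) u = w.
Proof.
move=> Ac cp sb nb bw.
have sffE v : dot eps (sff eps f c p u v) (b p) = dot eps (pd c f w p) (pd c f v p).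
  rewrite /sff nproj_dot; [|exact: tangent0|exact: nb].
  have d1 := immersion_pd_diff v Ac cp.
  have d2 := smooth_diff_param Ac cp I sb.
  have := pd_dot u d1 d2; rewrite (coordK (hA Ac) cp).
  rewrite (pd_near (f' := fun=> 0) _ (hA Ac) openT) //; last first.
    by move=> q cq _; rewrite dotC nb //; exists v.
  rewrite pd_cst bw dotNr => E; apply/eqP; rewrite -subr_eq0 -[X in _ - X]dotC.
  by rewrite -E.
(* Uniqueness: two candidates differ by a vector whose image is tangent and orthogonal to all
   tangent vectors, and the induced metric is definite. *)
apply: xget_unique => [v|w' H] /=; first by rewrite sffE.
apply/eqP; rewrite -subr_eq0; apply/eqP; apply: (pd_immersion_eq0 Ac cp).
apply: (tangent_eq0 Ac cp); first by exists (w' - w).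
have E v : dot eps (pd c f w' p) (pd c f v p) = dot eps (pd c f w p) (pd c f v p).
  by rewrite -sffE -H.
by rewrite {1}pd_immersionD // pd_immersionN // dotDl dotNl E subrr.
Qed.

End InQuadric.
End Immersions.

(** * The induced metric and change of charts *)

Section InducedMetric.
Context {R : realType} (eps : R) (heps : eps = 1 \/ eps = -1) {N : nat}.
Context {M : topologicalType} {V : normedModType R}.
Context (A : set (chart M V)) (f : M -> 'rV[R]_N).

Lemma pd_change (W : normedModType R) (g : M -> W) c c' p u :
  smooth_atlas A -> smooth_map_on A setT g ->
  A c -> A c' -> dom c p -> dom c' p ->
  pd c g u p = pd c' g (pd c (coord c') u p) p.
Proof.
move=> [hA _ tA] sg Ac Ac' cp c'p.
have [hc hc'] := (hA _ Ac, hA _ Ac').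
have oD' : open (dom c') by case: hc'.
have Ip : (coord c @` (dom c `&` dom c')) (coord c p) by exists p.
rewrite /pd.
have E : (coord c' \o param c) (coord c p) = coord c' p by rewrite /= coordK.
rewrite -[in RHS]E -derive_chain; last 2 first.
- exact: smooth_diff (tA _ _ Ac Ac') Ip.
- by rewrite E; exact: (smooth_diff_param Ac' c'p I sg).
apply: near_eq_derive; apply: (open_near (open_coord_image hc oD') Ip).
by move=> x [q [cq c'q] <-] /=; rewrite coordK // coordK.
Qed.

Lemma riemannian_induced_metric : smooth_atlas A -> immersion A f ->
  (forall p, dot eps (f p) (f p) = eps) -> riemannian_metric A (induced_metric eps f).
Proof.
move=> atA fimm ff; have [hA _ _] := atA; split; last split.
- move=> c p Ac cp; split.
  + by move=> a u u' v; rewrite /induced_metric (pd_immersionP fimm) // dotDl dotZl.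
  + by move=> u v; rewrite /induced_metric dotC.
  + move=> u u0; apply: (tangent_pos heps hA fimm ff Ac cp); first by exists u.
    by apply: contra u0 => /eqP /(pd_immersion_eq0 fimm Ac cp) ->.
- move=> c c' p Ac Ac' cp c'p u v.
  by rewrite /induced_metric !(@pd_change _ f c c' p) //; exact: fimm.1.
- move=> c u v Ac; have oc := open_img (hA _ Ac).
  have S w : smooth_on (img c) (fun x => pd c f w (param c x)).
    have := smooth_pd w (hA _ Ac) Ac openT fimm.1.
    by rewrite setIT.
  exact: smooth_dot.
Qed.

End InducedMetric.

(** * The direct part *)

Section Direct.
Context {R : realType} (eps : R) (heps : eps = 1 \/ eps = -1) {N s : nat}.
Context {M0 M1 : topologicalType} {V0 V1 : normedModType R}.
Context (A0 : set (chart M0 V0)) (A1 : set (chart M1 V1)).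
Context (hA0 : smooth_atlas A0) (hA1 : smooth_atlas A1).
Context (f1 : M1 -> 'rV[R]_N) (E : M1 -> {vspace 'rV[R]_N}).
Context (phi : M1 -> 'rV[R]_s -> 'rV[R]_N) (e1 : 'rV[R]_s) (f0 : M0 -> 'rV[R]_s).
Hypothesis hdata : polar_data eps A0 A1 f1 E phi e1 f0.

Local Notation F := (fun p : M0 * M1 => phi p.2 (f0 p.1)).
Local Notation PA := (prod_atlas A0 A1).
Local Notation B := (fun i p => phi p (delta_mx 0 i)).

Let c0P c : A0 c -> is_chart c. Proof. by case: hA0 => + _ _; apply. Qed.
Let c1P c : A1 c -> is_chart c. Proof. by case: hA1 => + _ _; apply. Qed.

Let f1imm : immersion A1 f1. Proof. by case: hdata => -[]. Qed.
Let f1Q p : Q eps N (f1 p). Proof. by case: hdata => -[_ +] _ _ _ _; apply. Qed.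
Let f11 p : dot eps (f1 p) (f1 p) = eps. Proof. by case: (f1Q p). Qed.
Let f0imm : immersion A0 f0. Proof. by case: hdata => _ _ _ _ []. Qed.
Let f0Q p : Q eps s (f0 p). Proof. by case: hdata => _ _ _ _ [_ /(_ p)[]]. Qed.
Let f00 p : dot eps (f0 p) (f0 p) = eps. Proof. by case: (f0Q p). Qed.
Let phiE p : linear (phi p). Proof. by case: hdata => _ _ [_ _ + _ _] _ _; apply. Qed.
Let phi_dot p y z : dot eps (phi p y) (phi p z) = dot eps y z.
Proof. by case: hdata => _ _ [_ _ _ + _] _ _; apply. Qed.

Let phiD p y z : phi p (y + z) = phi p y + phi p z.
Proof. by have := phiE p 1 y z; rewrite !scale1r. Qed.
Let phi0 p : phi p 0 = 0.
Proof. by have := phiE p (-1) 0 0; rewrite scaler0 addr0 scaleN1r addNr. Qed.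
Let phiZ p a y : phi p (a *: y) = a *: phi p y.
Proof. by have := phiE p a y 0; rewrite phi0 !addr0. Qed.

Let phi_sum p y : phi p y = \sum_i y 0 i *: B i p.
Proof.
rewrite {1}(row_sum_delta y).
suff H (l : seq 'I_s) : phi p (\sum_(i <- l) y 0 i *: delta_mx 0 i)
    = \sum_(i <- l) y 0 i *: B i p by exact: H.
by elim: l => [|i l IH]; rewrite ?big_nil ?phi0 // !big_cons phiD phiZ IH.
Qed.

Let phi_smooth y : smooth_map_on A1 setT (fun p => phi p y).
Proof.
apply/smooth_mapT => c Ac; case: hdata => _ _ [/(_ c Ac) S _ _ _ _] _ _.
have := smooth_affine (V' := V1) (0, y) (@continuous_inl R V1 'rV[R]_s) S.
have Ey (x : V1) : inl_lin x + (0, y) = (x, y) :> V1 * 'rV[R]_s.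
  by congr pair; rewrite /= ?add0r ?addr0.
rewrite (_ : (fun x => _) = (fun p => phi p y) \o param c); last first.
  by apply/funext => x; rewrite Ey.
by apply: smooth_sub => x ix; rewrite /mkset Ey.
Qed.

Let phi_diff c p y : A1 c -> dom c p -> differentiable ((fun q => phi q y) \o param c) (coord c p).
Proof. by move=> Ac cp; exact: (smooth_diff_param Ac cp I (phi_smooth y)). Qed.

Let phi_pd c p y u : A1 c -> dom c p ->
  pd c (fun q => phi q y) u p = \sum_i y 0 i *: pd c (B i) u p.
Proof.
move=> Ac cp; have -> : (fun q => phi q y) = (fun q => \sum_i y 0 i *: B i q).
  by apply/funext => q; exact: phi_sum.
by apply: pd_comb_cst => i; exact: phi_diff.
Qed.

Let phi_normal c p y : A1 c -> dom c p -> normal_space eps f1 c p (phi p y).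
Proof.
move=> Ac cp; case: hdata => _ [[_ H _] _ _ _] [_ inE _ _ _] _ _.
by apply: H => //; exact: inE.
Qed.

(** A vector with zero normal part equals its own projection, and [proj_in] places that in the
    tangent space. *)
Let phi_tangent c p u y : A1 c -> dom c p ->
  tangent f1 c p (pd c (fun q => phi q y) u p).
Proof.
move=> Ac cp; case: hdata => _ _ [_ _ _ _ H] _ _; have := H c p u y Ac cp.
rewrite /nabla_perp /nproj => /eqP; rewrite subr_eq0 => /eqP ->.
by apply: proj_in; exact: tangent0.
Qed.

(** The slice over [p0] is [f1] plus the parallel normal field [phi (f0 p0 - e1)], which explains
    the translation by [e1] of [Omega]: the condition says that [P] is bijective at every point. *)
Let slice_P c p0 p : A1 c -> dom c p -> exists P : V1 -> V1, bijective P /\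
  forall u, pd c (fun q => phi q (f0 p0)) u p = pd c f1 (P u) p.
Proof.
move=> Ac cp; exists (fun u => u - shape_op eps f1 c p (phi p (f0 p0 - e1)) u).
split; first by case: hdata => _ _ _ _ [_ /(_ p0)[+ _]]; apply.
move=> u; have [z _ Ez] := phi_tangent u (f0 p0 - e1) Ac cp.
rewrite (shape_op_eq heps c1P f1imm f11 (b := fun q => phi q (f0 p0 - e1)) (w := - z)) //.
- rewrite opprK (pd_immersionD f1imm) // Ez.
  have -> : (fun q => phi q (f0 p0)) = (fun q => f1 q + phi q (f0 p0 - e1)).
    apply/funext => q; case: hdata => _ _ _ [/(_ q) -> _] _.
    by rewrite -phiD addrC subrK.
  rewrite /pd (@deriveD _ _ _ (f1 \o param c) ((fun q => phi q (f0 p0 - e1)) \o param c)) //.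
    by apply: diff_derivable; exact: (immersion_diff f1imm).
  by apply: diff_derivable; exact: phi_diff.
- by move=> q cq; exact: phi_normal.
- by rewrite (pd_immersionN f1imm) // opprK.
Qed.

Let FE : F = fun p => \sum_i f0 p.1 0 i *: B i p.2.
Proof. by apply/funext => p; exact: phi_sum. Qed.

Let F_smooth : smooth_map_on PA setT F.
Proof.
apply/smooth_mapT => _ [c0 [c1 [Ac0 Ac1 ->]]].
have oI : open (img c0 `*` img c1) by apply: open_prod; [case: (c0P Ac0)|case: (c1P Ac1)].
rewrite FE img_prod; apply: smooth_sum => // i; apply: smooth_scale => //.
  apply: (@smooth_fst _ _ _ _ _ _ (fun x => f0 (param c0 x) 0 i)).
  apply: smooth_coef; first by case: (c0P Ac0).
  by move/smooth_mapT: (f0imm.1); apply.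
apply: (@smooth_snd _ _ _ _ _ _ (fun x => B i (param c1 x))).
by move/smooth_mapT: (phi_smooth (delta_mx 0 i)); apply.
Qed.

Let pd1 c0 p0 p1 u : A0 c0 -> dom c0 p0 ->
  pd c0 (fun q => phi p1 (f0 q)) u p0 = phi p1 (pd c0 f0 u p0).
Proof.
move=> Ac cp; rewrite phi_sum.
under eq_fun do rewrite phi_sum.
by apply: pd_comb; exact: (immersion_diff f0imm).
Qed.

Let pdF c0 c1 p0 p1 u : A0 c0 -> A1 c1 -> dom c0 p0 -> dom c1 p1 ->
  pd (prod_chart c0 c1) F u (p0, p1)
  = phi p1 (pd c0 f0 u.1 p0) + pd c1 (fun q => phi q (f0 p0)) u.2 p1.
Proof.
move=> Ac0 Ac1 d0 d1.
have -> : u = 1 *: (u.1, 0) + (0, u.2).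
  by case: u => u0 u1; congr pair; rewrite /= ?addr0 ?scaler0 ?add0r ?scale1r.
rewrite pd_linear ?scale1r.
  by rewrite pd_prod1 ?pd_prod2 /= ?scale1r ?addr0 ?scaler0 ?add0r ?pd1 //; [exact: c0P|exact: c1P].
apply: (smooth_diff_param (prod_atlas_chart Ac0 Ac1) _ I F_smooth).
by split.
Qed.

Let slice_orth c1 p0 p1 y u : A1 c1 -> dom c1 p1 ->
  dot eps (phi p1 y) (pd c1 (fun q => phi q (f0 p0)) u p1) = 0.
Proof. by move=> Ac cp; apply: (phi_normal y Ac cp); exact: phi_tangent. Qed.

Let F_imm : immersion PA F.
Proof.
split=> [|_ [p0 p1] [c0 [c1 [Ac0 Ac1 ->]]] [/= d0 d1]]; first exact: F_smooth.
have [P [Pbij PE]] := slice_P p0 Ac1 d1.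
suff K u : pd (prod_chart c0 c1) F u (p0, p1) = 0 -> u = 0.
  move=> u v uv; apply/eqP; rewrite -subr_eq0; apply/eqP/K.
  have dF : differentiable (F \o param (prod_chart c0 c1)) (coord (prod_chart c0 c1) (p0, p1)).
    by apply: (smooth_diff_param (prod_atlas_chart Ac0 Ac1) _ I F_smooth).
  have := pd_linear (-1) v u dF; rewrite scaleN1r [- v + u]addrC => ->.
  by rewrite [in X in _ + X]uv scaleN1r addNr.
rewrite pdF //= => u0.
(* If the orthogonal sum vanishes, its slice part is orthogonal to itself; being tangent to [f1], it
   is zero. *)
have u20 : pd c1 (fun q => phi q (f0 p0)) u.2 p1 = 0.
  apply: (tangent_eq0 heps c1P f1imm f11 Ac1 d1); first exact: phi_tangent.
  have := slice_orth p0 (pd c0 f0 u.1 p0) u.2 Ac1 d1.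
  rewrite -(addrK (pd c1 (fun q => phi q (f0 p0)) u.2 p1) (phi _ _)) u0 sub0r dotNl.
  by move/eqP; rewrite oppr_eq0 => /eqP.
(* [phi p1] preserves a nondegenerate form, hence is injective. *)
have u10 : pd c0 f0 u.1 p0 = 0.
  apply: (dot_nondegenerate heps) => y; rewrite -(phi_dot p1).
  by move: u0; rewrite u20 addr0 => ->; rewrite dot0l.
case: u u0 u20 u10 => u v /= _ v0 u0; congr pair.
  exact: (pd_immersion_eq0 f0imm Ac0 d0).
apply: (bij_inj Pbij); apply: (f1imm.2 c1 p1 Ac1 d1).
by rewrite -!PE v0 pd0.
Qed.

(** Time orientation is compared with that of [f1 p.2], the image of [e1]: by isometry the product
    is that of [e1] and [f0 p.1], which lie on the same sheet. *)
Let F_Q p : Q eps N (F p).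
Proof.
apply: (Q_timelike (f1Q p.2)) => [|e]; first by rewrite /= phi_dot f00.
case: hdata => _ _ _ [/(_ p.2) -> Qe] _; rewrite phi_dot.
exact: (Q_dot_lt0 heps e Qe).
Qed.

Let FF p : dot eps (F p) (F p) = eps. Proof. by case: (F_Q p). Qed.

Let PAchart c : PA c -> is_chart c.
Proof. by case=> c0 [c1 [Ac0 Ac1 ->]]; apply: is_chart_prod; [exact: c0P|exact: c1P]. Qed.

Let slice_imm p0 : immersion A1 (fun q => phi q (f0 p0)).
Proof.
split=> [|c1 p1 Ac1 d1 u v /= uv]; first exact: phi_smooth.
have [_ cov0 _] := hA0; have [c0 Ac0 d0] := cov0 p0.
have /= := F_imm.2 _ (p0, p1) (prod_atlas_chart Ac0 Ac1) (conj d0 d1) (0, u) (0, v).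
rewrite !pdF //= uv => /(_ erefl) => H.
by case: H.
Qed.

(** Each [phi p1] being an isometry, the base block of the metric is the one induced by [f0],
    whatever [p1] is. *)
Let F_polar : polar_metric A0 A1 (induced_metric eps F).
Proof.
exists (induced_metric eps f0), (fun p0 => induced_metric eps (fun q => phi q (f0 p0))).
split.
- exact: riemannian_induced_metric.
- split=> [p0|c0 c1 u v Ac0 Ac1].
    apply: (riemannian_induced_metric heps hA1 (slice_imm p0)) => p.
    exact: (FF (p0, p)).
  have hP := PAchart (prod_atlas_chart Ac0 Ac1).
  have S w : smooth_on (img (prod_chart c0 c1))
      (fun x => pd c1 (fun q => phi q (f0 (param c0 x.1))) w (param c1 x.2)).
    have := smooth_pd (0, w) hP (prod_atlas_chart Ac0 Ac1) openT F_smooth.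
    rewrite setIT -/(img _); apply: smooth_eq; first exact: open_img.
    rewrite img_prod => -[x0 x1] [/= i0 i1].
    rewrite pd_prod2 //; first exact: c0P.
    by apply: dom_param => //; exact: c0P.
  by apply: smooth_dot => //; exact: open_img.
- move=> c0 c1 p0 p1 Ac0 Ac1 d0 d1 X Y; rewrite /induced_metric !pdF //.
  rewrite dotDl !dotDr phi_dot slice_orth // addr0; congr (_ + _).
  by rewrite dotC slice_orth // add0r.
Qed.

Let F_adapted : adapted_to_product eps A0 A1 F.
Proof.
move=> c0 c1 [p0 p1] Ac0 Ac1 /= d0 d1 u0 u1.
have PAc := prod_atlas_chart Ac0 Ac1.
have dp : dom (prod_chart c0 c1) (p0, p1) by [].
have [P [[P' _ PK] PE]] := slice_P p0 Ac1 d1.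
have -> : sffQ eps F (prod_chart c0 c1) (p0, p1) (u0, 0) (0, u1) =
    nproj eps (tangent F (prod_chart c0 c1) (p0, p1)) (proj eps
      (tangentQ eps (F (p0, p1))) (pd c1 (fun q => phi q (pd c0 f0 u0 p0)) u1 p1)).
  rewrite /sffQ; congr (nproj _ _ (proj _ _ _)).
  rewrite pd_prod1 //; last exact: c1P.
  rewrite (pd_near (f' := fun q0 => \sum_i f0 q0 0 i *: pd c1 (B i) u1 p1) _ (c0P Ac0) openT) //.
    rewrite pd_comb; last exact: (immersion_diff f0imm).
    by rewrite phi_pd.
  move=> q0 dq0 _; rewrite (pd_prod2 c1 F u1 p1 (c0P Ac0) dq0).
  exact: (phi_pd (f0 q0) u1 Ac1 d1).
have Tw : tangent F (prod_chart c0 c1) (p0, p1) (pd c1 (fun q => phi q (pd c0 f0 u0 p0)) u1 p1).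
  have [z _ <-] := phi_tangent u1 (pd c0 f0 u0 p0) Ac1 d1.
  (* Surjectivity of [P] turns a vector tangent to [f1] into one tangent to the slice, hence to
     [F]. *)
  exists (0, P' z) => //; rewrite pdF //= PE PK.
  by rewrite pd0 phi0 add0r.
(* Being tangent to [F], the mixed derivative is tangent to the quadric: the inner projection fixes
   it and the outer normal projection kills it. *)
rewrite (@proj_eq _ _ _ _ _ _ _ (pd c1 (fun q => phi q (pd c0 f0 u0 p0)) u1 p1)).
- exact: (nproj_tangent_eq0 heps PAchart F_imm FF PAc dp).
- by move=> a b; rewrite /tangentQ /= dotDl dotNl => -> ->; rewrite subrr.
- move=> t tF tt; apply/eqP/negP => /negP t0.
  by have := spacelike heps (FF (p0, p1)) tF t0; rewrite tt ltxx.
- exact: (tangent_orth PAchart F_imm FF PAc dp).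
- by move=> t _; rewrite subrr dot0l.
Qed.

Lemma polar_data_immersion : polar_adapted_immersion eps A0 A1 F.
Proof. by split; [exact: F_imm|exact: F_Q|exact: F_polar|exact: F_adapted]. Qed.

End Direct.

(** * The slices of a polar adapted immersion *)

Section MixedDerivatives.
Context {R : realType} (eps : R) {N : nat}.

(* [S u v := <D_u D_w h, D_v h>] is symmetric in [u], [v] because
   [<D_w h, D_u D_v h>] is, and skew because [<D_u h, D_v h>] is constant
   along [w]. *)
Lemma mixed_derive_orth (V : normedModType R) (U : set V) (h : V -> 'rV[R]_N) u v w x :
  open U -> smooth_on U h ->
  (forall y, U y -> dot eps ('D_w h y) ('D_u h y) = 0) ->
  (forall y, U y -> dot eps ('D_w h y) ('D_v h y) = 0) ->
  (forall y, U y -> 'D_w (fun z => dot eps ('D_u h z) ('D_v h z)) y = 0) ->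
  U x -> dot eps ('D_u ('D_w h) x) ('D_v h x) = 0.
Proof.
move=> oU sh wu wv wuv Ux.
have dD a : differentiable ('D_a h) x by apply: smooth_diff Ux; exact: smooth_D.
have zero a b : (forall y, U y -> dot eps ('D_w h y) ('D_b h y) = 0) ->
    dot eps ('D_a ('D_w h) x) ('D_b h x) + dot eps ('D_w h x) ('D_a ('D_b h) x) = 0.
  move=> H; rewrite -derive_dot //.
  rewrite (near_eq_derive (g := cst (0 : R)) a (open_near oU Ux H)).
  exact: derive_cst.
have alg (wu' wv' uw' vw' uv' vu' du dv dw : 'rV[R]_N) :
    wu' = uw' -> wv' = vw' -> vu' = uv' ->
    dot eps uw' dv + dot eps dw uv' = 0 -> dot eps vw' du + dot eps dw vu' = 0 ->
    dot eps wu' dv + dot eps du wv' = 0 -> dot eps uw' dv = 0.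
  by move=> -> -> -> E1 E2; rewrite [dot _ du _]dotC; lra.
exact: (alg _ _ _ _ _ _ _ _ _ (derive_symm w u oU sh Ux) (derive_symm w v oU sh Ux)
  (derive_symm v u oU sh Ux) (zero u v wv) (zero v u wu)
  (etrans (esym (derive_dot eps w (dD u) (dD v))) (wuv x Ux))).
Qed.

Lemma pd_symm (M : topologicalType) (V : normedModType R) (A : set (chart M V)) c (U : set M)
    (a : M -> R) u v p : is_chart c -> A c -> open U -> dom c p -> U p ->
  smooth_map_on A U a -> pd c (pd c a v) u p = pd c (pd c a u) v p.
Proof.
move=> hc Ac oU cp Up sa.
have oI := open_coord_image hc oU.
have Ip : (coord c @` (dom c `&` U)) (coord c p) by exists p.
have E w w' : pd c (pd c a w) w' p = 'D_w' ('D_w (a \o param c)) (coord c p).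
  apply: near_eq_derive; apply: (open_near oI Ip) => x [q [cq _] <-] /=.
  by rewrite /pd coordK.
rewrite (E v u) (E u v).
exact: (derive_symm_scalar u v oI (sa c Ac) Ip).
Qed.

End MixedDerivatives.

Lemma nproj_proj_eq0 (R : realType) (eps : R) n (T : set 'rV[R]_n) (x w : 'rV[R]_n) :
  eps = 1 \/ eps = -1 -> T 0 -> dot eps x x = eps -> dot eps w x = 0 ->
  nproj eps T (proj eps (tangentQ eps x) w) = 0 -> T w.
Proof.
move=> heps T0 xx wx; rewrite (proj_tangentQ heps) // wx mulr0 scale0r subr0.
by rewrite /nproj => /eqP; rewrite subr_eq0 => /eqP ->; exact: proj_in.
Qed.

Section AdaptedSlices.
Context {R : realType} (eps : R) (heps : eps = 1 \/ eps = -1) {N n0 n1 : nat}.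
Context {M0 M1 : topologicalType}.
Context (A0 : set (chart M0 'rV[R]_n0)) (A1 : set (chart M1 'rV[R]_n1)).
Context (hA0 : smooth_atlas A0) (hA1 : smooth_atlas A1).
Context (f : M0 * M1 -> 'rV[R]_N).
Hypothesis hf : polar_adapted_immersion eps A0 A1 f.

Local Notation PA := (prod_atlas A0 A1).

Let c0P c : A0 c -> is_chart c. Proof. by case: hA0 => + _ _; apply. Qed.
Let c1P c : A1 c -> is_chart c. Proof. by case: hA1 => + _ _; apply. Qed.

Let PAchart c : PA c -> is_chart c.
Proof. by case=> c0 [c1 [Ac0 Ac1 ->]]; apply: is_chart_prod; [exact: c0P|exact: c1P]. Qed.

Let fimm : immersion PA f. Proof. by case: hf. Qed.
Let ff p : dot eps (f p) (f p) = eps. Proof. by case: hf => _ /(_ p)[]. Qed.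

Lemma polar_orth c0 c1 p0 p1 u0 u1 : A0 c0 -> A1 c1 -> dom c0 p0 -> dom c1 p1 ->
  dot eps (pd (prod_chart c0 c1) f (u0, 0) (p0, p1))
    (pd (prod_chart c0 c1) f (0, u1) (p0, p1)) = 0.
Proof.
move=> Ac0 Ac1 d0 d1; case: hf => _ _ [g0 [g1 [rg0 [rg1 _] gE]]] _.
have := gE c0 c1 p0 p1 Ac0 Ac1 d0 d1 (u0, 0) (0, u1); rewrite /induced_metric /= => ->.
have [l0 s0 _] := rg0.1 c0 p0 Ac0 d0.
have [l1 s1 _] := (rg1 p0).1 c1 p1 Ac1 d1.
have z0 v : g0 c0 p0 0 v = 0.
  by have := l0 1 0 0 v; rewrite scale1r addr0 mul1r; lra.
have z1 v : g1 p0 c1 p1 0 v = 0.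
  by have := l1 1 0 0 v; rewrite scale1r addr0 mul1r; lra.
by rewrite s0 z0 z1 addr0.
Qed.

(** The base block is [g0], which sees only [p0]. This supplies the constancy along [M1] that
    [mixed_derive_orth] requires. *)
Lemma polar_base c0 c1 p0 p1 q1 u0 v0 :
  A0 c0 -> A1 c1 -> dom c0 p0 -> dom c1 p1 -> dom c1 q1 ->
  dot eps (pd (prod_chart c0 c1) f (u0, 0) (p0, p1))
    (pd (prod_chart c0 c1) f (v0, 0) (p0, p1))
  = dot eps (pd (prod_chart c0 c1) f (u0, 0) (p0, q1))
    (pd (prod_chart c0 c1) f (v0, 0) (p0, q1)).
Proof.
move=> Ac0 Ac1 d0 d1 d1'; case: hf => _ _ [g0 [g1 [rg0 [rg1 _] gE]]] _.
have := gE c0 c1 p0 p1 Ac0 Ac1 d0 d1 (u0, 0) (v0, 0); rewrite /induced_metric /= => ->.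
have := gE c0 c1 p0 q1 Ac0 Ac1 d0 d1' (u0, 0) (v0, 0); rewrite /induced_metric /= => ->.
have z1 q v : dom c1 q -> g1 p0 c1 q 0 v = 0.
  move=> dq; have [l1 s1 _] := (rg1 p0).1 c1 q Ac1 dq.
  by have := l1 1 0 0 v; rewrite scale1r addr0 mul1r; lra.
by rewrite !z1.
Qed.

Lemma slice_immersion p0 : immersion A1 (fun q => f (p0, q)).
Proof.
split=> [|c1 p1 Ac1 d1 u v /= uv]; first exact: smooth_slice2 hA0 fimm.1.
have [_ cov0 _] := hA0; have [c0 Ac0 d0] := cov0 p0.
have /= := fimm.2 _ (p0, p1) (prod_atlas_chart Ac0 Ac1) (conj d0 d1) (0, u) (0, v).
by rewrite !(pd_prod2 c1 f _ p1 (c0P Ac0) d0) uv => /(_ erefl) [].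
Qed.

Lemma pd_slice_mixed c0 c1 p0 p1 u0 u1 : A0 c0 -> A1 c1 -> dom c0 p0 -> dom c1 p1 ->
  pd c0 (fun q0 => pd c1 (fun q => f (q0, q)) u1 p1) u0 p0
  = pd (prod_chart c0 c1) (pd (prod_chart c0 c1) f (0, u1)) (u0, 0) (p0, p1).
Proof.
move=> Ac0 Ac1 d0 d1; rewrite (pd_prod1 c0 _ u0 p0 (c1P Ac1) d1).
apply: (pd_near u0 (c0P Ac0) openT d0 I) => q0 dq0 _.
exact: (esym (pd_prod2 c1 f u1 p1 (c0P Ac0) dq0)).
Qed.

(** By polarity the mixed derivative [w] is orthogonal to the [M0] directions and to [f]. The latter
    makes [w] its own projection to the quadric, so adaptedness puts it in the tangent space of [f];
    the former removes its [M0] component. *)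
Lemma mixed_in_slice c0 c1 p0 p1 u0 u1 : A0 c0 -> A1 c1 -> dom c0 p0 -> dom c1 p1 ->
  tangent (fun q => f (p0, q)) c1 p1
    (pd (prod_chart c0 c1) (pd (prod_chart c0 c1) f (0, u1)) (u0, 0) (p0, p1)).
Proof.
move=> Ac0 Ac1 d0 d1.
set c := prod_chart c0 c1; set w := pd c _ _ _.
have Ac : PA c := prod_atlas_chart Ac0 Ac1.
have hc := PAchart Ac.
have cp : dom c (p0, p1) by [].
have oI := open_img hc.
pose h := f \o param c.
have sh : smooth_on (img c) h by move/smooth_mapT: fimm.1 => /(_ c Ac).
have pdE u x : img c x -> pd c f u (param c x) = 'D_u h x by move=> ix; exact: pd_param.
have wE : w = 'D_(u0, 0) ('D_(0, u1) h) (coord c (p0, p1)).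
  apply: near_eq_derive; apply: (open_near oI (img_coord cp)) => x ix.
  exact: pdE.
have hpE u : pd c f u (p0, p1) = 'D_u h (coord c (p0, p1)) by [].
have orth a b x : img c x -> dot eps ('D_(0, b) h x) ('D_(a, 0) h x) = 0.
  move=> ix; have [q0 q1] := dom_param hc ix.
  have po : dot eps (pd c f (a, 0) (param c x)) (pd c f (0, b) (param c x)) = 0.
    exact: (polar_orth a b Ac0 Ac1 q0 q1).
  have E := congr2 (@dot R eps N) (pdE (0, b) x ix) (pdE (a, 0) x ix).
  exact: (etrans (esym E) (etrans (dotC eps _ _) po)).
have base_const u v y : img c y ->
    'D_(0, u1) (fun z => dot eps ('D_(u, 0) h z) ('D_(v, 0) h z)) y = 0.
  move=> iy.
  (* The base block is evaluated over the fixed point [p1], which displays it as a function of the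
     first coordinate alone; its derivative along [(0, u1)] is a derivative along 0. *)
  pose k (x0 : 'rV[R]_n0) := dot eps (pd c f (u, 0) (param c0 x0, p1))
    (pd c f (v, 0) (param c0 x0, p1)).
  have kE x : img c x -> dot eps ('D_(u, 0) h x) ('D_(v, 0) h x) = k x.1.
    move=> ix; have [q0 q1] := dom_param hc ix.
    have E := congr2 (@dot R eps N) (pdE (u, 0) x ix) (pdE (v, 0) x ix).
    exact: (etrans (esym E) (polar_base u v Ac0 Ac1 q0 q1 d1)).
  have kfst : 'D_(0, u1) (k \o fst) y = 'D_0 k y.1.
    by apply: derive_affine => t /=; rewrite scaler0.
  exact: (etrans (near_eq_derive (g := k \o fst) _ (open_near oI iy kE))
    (etrans kfst (derive0 _ _))).
have w_orth v0 : dot eps w (pd c f (v0, 0) (p0, p1)) = 0.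
  have W := mixed_derive_orth oI sh (orth u0 u1) (orth v0 u1) (base_const u0 v0) (img_coord cp).
  exact: (etrans (congr2 (@dot R eps N) wE (hpE (v0, 0))) W).
(* The relation between [f] and its derivative along [u1] is differentiated along [u0]; the other
   term vanishes by [polar_orth]. *)
have wf : dot eps w (f (p0, p1)) = 0.
  have d1f := immersion_pd_diff PAchart fimm (0, u1) Ac cp.
  have d2f := immersion_diff fimm Ac cp.
  have PD := pd_dot eps (u0, 0) d1f d2f; rewrite (coordK hc cp) in PD.
  have Z q : dom c q -> setT q -> dot eps (pd c f (0, u1) q) (f q) = 0.
    by move=> cq _; apply: (tangent_orth PAchart fimm ff Ac cq); exists (0, u1).
  have Z0 := etrans (pd_near (u0, 0) hc openT cp I Z) (pd_cst c 0 _ _).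
  have po := polar_orth u0 u1 Ac0 Ac1 d0 d1; rewrite dotC in po.
  have lin (x y z : R) : x = y + z -> x = 0 -> z = 0 -> y = 0 by lra.
  exact: (lin _ _ _ PD Z0 po).
have [[a b] _ ab] : tangent f c (p0, p1) w.
  case: hf => _ _ _ H.
  exact: (nproj_proj_eq0 heps (tangent0 c (p0, p1)) (ff _) wf
    (H c0 c1 (p0, p1) Ac0 Ac1 d0 d1 u0 u1)).
have abE : (a, b) = (a, 0) + (0, b) by congr pair; rewrite /= ?addr0 ?add0r.
have po := polar_orth a b Ac0 Ac1 d0 d1; rewrite dotC in po.
have sumE := pd_immersionD fimm (a, 0) (0, b) Ac cp.
have wE' : w = pd c f (a, 0) (p0, p1) + pd c f (0, b) (p0, p1).
  by rewrite -sumE -abE.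
have Ea : pd c f (a, 0) (p0, p1) = 0.
  apply: (tangent_eq0 heps PAchart fimm ff Ac cp); first by exists (a, 0).
  have := w_orth a; rewrite wE' dotDl => aa.
  exact: (etrans (esym (etrans (congr1 (fun z => _ + z) po) (addr0 _))) aa).
exists b; first exact: I.
apply: (etrans (esym (pd_prod2 c1 f b p1 (c0P Ac0) d0))).
exact: (esym (etrans wE' (etrans (congr1 (fun z => z + _) Ea) (add0r _)))).
Qed.

(** Its row space is the tangent space of the slice, the form in which [span_near_const] can be
    applied. *)
Let slice_jac (c1 : chart M1 'rV[R]_n1) p1 p0 : 'M[R]_(n1, N) :=
  \matrix_j pd c1 (fun q => f (p0, q)) (delta_mx 0 j) p1.

Let slice_jacE c1 p1 p0 u : A1 c1 -> dom c1 p1 ->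
  pd c1 (fun q => f (p0, q)) u p1 = u *m slice_jac c1 p1 p0.
Proof.
move=> Ac1 d1; have imm := slice_immersion p0.
rewrite mulmx_sum_row {1}(row_sum_delta u).
have H (l : seq 'I_n1) : pd c1 (fun q => f (p0, q)) (\sum_(i <- l) u 0 i *: delta_mx 0 i) p1
    = \sum_(i <- l) u 0 i *: row i (slice_jac c1 p1 p0).
  elim: l => [|i l IH]; first by rewrite !big_nil pd0.
  by rewrite !big_cons (pd_immersionP imm _ _ _ Ac1 d1) IH rowK.
exact: H.
Qed.

Let slice_tangentE c1 p1 p0 t : A1 c1 -> dom c1 p1 ->
  tangent (fun q => f (p0, q)) c1 p1 t <-> (t <= slice_jac c1 p1 p0)%MS.
Proof.
move=> Ac1 d1; split=> [[u _ <-]|/submxP[u ->]].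
  by rewrite slice_jacE // submxMl.
by exists u => //; rewrite slice_jacE.
Qed.

Let slice_jac_free c1 p1 p0 : A1 c1 -> dom c1 p1 -> row_free (slice_jac c1 p1 p0).
Proof.
move=> Ac1 d1; apply: inj_row_free => u; rewrite -slice_jacE // => u0.
exact: (pd_immersion_eq0 (slice_immersion p0) Ac1 d1).
Qed.

(** By [mixed_in_slice], the derivatives in [p0] of the rows of [slice_jac] stay in its row space,
    which makes that space locally constant; connectedness of [M0] does the rest. *)
Lemma slice_tangent_const c1 p1 p0 q0 : connected [set: M0] -> A1 c1 -> dom c1 p1 ->
  tangent (fun q => f (p0, q)) c1 p1 = tangent (fun q => f (q0, q)) c1 p1.
Proof.
move=> cM0 Ac1 d1; move: p0 q0.
apply: (locally_constant (g := fun p0 => tangent (fun q => f (p0, q)) c1 p1)) => // p0.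
have [_ cov0 _] := hA0; have [c0 Ac0 d0] := cov0 p0.
have hc0 := c0P Ac0.
pose Y := slice_jac c1 p1 \o param c0.
have rowY j : smooth_on (img c0)
    (fun x => pd c1 (fun q => f (param c0 x, q)) (delta_mx 0 j) p1).
  have sh : smooth_on (img (prod_chart c0 c1)) (f \o param (prod_chart c0 c1)).
    by move/smooth_mapT: fimm.1; apply; exact: prod_atlas_chart.
  have S := smooth_affine (0, coord c1 p1) continuous_inl (smooth_D (0, delta_mx 0 j) sh).
  have xE (x : 'rV[R]_n0) : inl_lin x + (0, coord c1 p1) = (x, coord c1 p1).
    by congr pair; rewrite /= ?add0r ?addr0.
  apply: (smooth_eq (open_img hc0) _ (smooth_sub _ S)) => x ix.
    have dx := dom_param hc0 ix.
    rewrite xE -(pd_prod2 c1 f (delta_mx 0 j) p1 hc0 dx).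
    by rewrite /pd /= paramK.
  by rewrite /mkset xE img_prod; split => //=; exact: img_coord.
have Yn : \forall x \near coord c0 p0, (Y (coord c0 p0) <= Y x)%MS.
  apply: (span_near_const (open_img hc0) (img_coord d0)).
  - move=> x ix i j; under eq_fun do rewrite /Y /= mxE.
    apply: (@differentiable_coef _ _ _
      (fun x => pd c1 (fun q => f (param c0 x, q)) (delta_mx 0 i) p1)).
    exact: smooth_diff (rowY i) ix.
  - move=> x v ix; apply/row_subP => i.
    have -> : row i (mxD v Y x) =
        pd c0 (fun q0 => pd c1 (fun q => f (q0, q)) (delta_mx 0 i) p1) v (param c0 x).
      have Yij j : (fun y => Y y i j) =
          (fun y => pd c1 (fun q => f (param c0 y, q)) (delta_mx 0 i) p1 0 j).
        by apply/funext => y; rewrite /Y /= mxE.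
      apply/rowP => j; rewrite !mxE Yij pd_param // -derive_coef //.
      exact: smooth_diff (rowY i) ix.
    apply/slice_tangentE => //.
    rewrite (pd_slice_mixed _ _ Ac0 Ac1 (dom_param hc0 ix) d1).
    exact: (mixed_in_slice v (delta_mx 0 i) Ac0 Ac1 (dom_param hc0 ix) d1).
  - exact: slice_jac_free.
apply: filterS (near_coord hc0 d0 Yn) => q [dq].
rewrite /Y /= !coordK // => sub; apply/funext => t; apply/propext.
(* Both Jacobians have full rank [n1], so the inclusion of row spaces is an equality. *)
have eqY : (slice_jac c1 p1 p0 :=: slice_jac c1 p1 q)%MS.
  have /eqP r1 := slice_jac_free p0 Ac1 d1; have /eqP r2 := slice_jac_free q Ac1 d1.
  apply/eqmxP/andP; split; first exact: sub.
  have <- := geq_leqif (mxrank_leqif_sup sub).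
  exact: (eq_leq (etrans r2 (esym r1))).
apply: (iff_trans (slice_tangentE q t Ac1 d1)); rewrite -(eqY : (_ :=: _)%MS).
exact: (iff_sym (slice_tangentE p0 t Ac1 d1)).
Qed.

End AdaptedSlices.

(** * Parallel normal frames *)

Section ParallelSections.
Context {R : realType} (eps : R) (heps : eps = 1 \/ eps = -1) {N : nat}.
Context {M : topologicalType} {V : normedModType R}.
Context (A : set (chart M V)) (hA : smooth_atlas A) (f1 : M -> 'rV[R]_N).
Hypothesis f1imm : immersion A f1.
Hypothesis f11 : forall p, dot eps (f1 p) (f1 p) = eps.

(** Vanishing of the normal derivative is phrased as tangency of the ordinary derivative, a linear
    condition free of projections. *)
Definition parallel_normal (b : M -> 'rV[R]_N) : Prop :=
  [/\ smooth_map_on A setT b,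
      forall c p u, A c -> dom c p -> tangent f1 c p (pd c b u p) &
      forall c p, A c -> dom c p -> normal_space eps f1 c p (b p)].

Let cP c : A c -> is_chart c. Proof. by case: hA => + _ _; apply. Qed.

Lemma parallel_normal_lin a b b' : parallel_normal b -> parallel_normal b' ->
  parallel_normal (fun p => a *: b p + b' p).
Proof.
move=> [sb tb nb] [sb' tb' nb']; split.
- apply/smooth_mapT => c Ac; have oc := open_img (cP Ac).
  move/smooth_mapT/(_ c Ac) : sb => sb; move/smooth_mapT/(_ c Ac) : sb' => sb'.
  apply: smoothD => //; apply: (smooth_scale (a := fun=> a)) => //.
  exact: smooth_cst.
- move=> c p u Ac cp.
  have db := smooth_diff_param Ac cp I sb; have db' := smooth_diff_param Ac cp I sb'.
  have -> : pd c (fun p => a *: b p + b' p) u p = a *: pd c b u p + pd c b' u p.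
    rewrite /pd (@deriveD _ _ _ (fun x => a *: (b \o param c) x) (b' \o param c)).
    + by rewrite (@derive_scale _ _ _ (fun=> a) (b \o param c)) // derive_cst scale0r addr0.
    + by apply: diff_derivable; exact: (differentiable_scale (a := fun=> a)).
    + exact: diff_derivable.
  have [v _ <-] := tb c p u Ac cp; have [w _ <-] := tb' c p u Ac cp.
  by exists (a *: v + w) => //; rewrite (pd_immersionP f1imm).
- move=> c p Ac cp t Tt; rewrite dotDl dotZl (nb c p Ac cp t Tt) (nb' c p Ac cp t Tt).
  by rewrite mulr0 addr0.
Qed.

(** Each term of the product rule pairs a tangent vector with a normal one. *)
Lemma parallel_normal_dot b b' p q : connected [set: M] ->
  parallel_normal b -> parallel_normal b' -> dot eps (b p) (b' p) = dot eps (b q) (b' q).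
Proof.
move=> cM [sb tb nb] [sb' tb' nb']; move: p q.
apply: (locally_constant (g := fun p => dot eps (b p) (b' p))) => // p.
have [_ cov _] := hA; have [c Ac cp] := cov p.
have hc := cP Ac.
apply: (@pd_eq0_near _ _ _ c (fun p => dot eps (b p) (b' p))) => //.
  apply: smooth_dot; first exact: open_img.
    by move/smooth_mapT/(_ c Ac) : sb.
  by move/smooth_mapT/(_ c Ac) : sb'.
move=> u q cq.
have db := smooth_diff_param Ac cq I sb; have db' := smooth_diff_param Ac cq I sb'.
have := pd_dot eps u db db'; rewrite (coordK hc cq) => ->.
rewrite dotC (nb' c q Ac cq _ (tb c q u Ac cq)) (nb c q Ac cq _ (tb' c q u Ac cq)).
by rewrite addr0.
Qed.

Context {s : nat} (b : 'I_s -> M -> 'rV[R]_N).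
Hypothesis pb : forall i, parallel_normal (b i).
Hypothesis ob : forall p, orthonormal_family eps (b^~ p).

Definition frame_span p : {vspace 'rV[R]_N} := <<[seq b i p | i <- enum 'I_s]>>%VS.
Definition frame_iso p (y : 'rV[R]_s) : 'rV[R]_N := \sum_i y 0 i *: b i p.

Let b_smooth i : smooth_map_on A setT (b i). Proof. by have [] := pb i. Qed.
Let b_diff i c p : A c -> dom c p -> differentiable (b i \o param c) (coord c p).
Proof. by move=> Ac cp; exact: smooth_diff_param Ac cp I (b_smooth i). Qed.

Lemma frame_iso_in p y : frame_iso p y \in frame_span p.
Proof.
apply: memv_suml => i _; apply: memvZ; apply: memv_span.
by apply/mapP; exists i => //; rewrite mem_enum.
Qed.

Lemma frame_iso_dot p y z : dot eps (frame_iso p y) (frame_iso p z) = dot eps y z.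
Proof. exact: orthonormal_dot2. Qed.

Lemma frame_iso_linear p : linear (frame_iso p).
Proof.
move=> a y z; rewrite /frame_iso scaler_sumr -big_split /=; apply: eq_bigr => i _.
by rewrite !mxE scalerDl scalerA.
Qed.

Lemma frame_basis p : basis_of (frame_span p) [seq b i p | i <- enum 'I_s].
Proof.
rewrite /basis_of eqxx /=.
have -> : [seq b i p | i <- enum 'I_s] = [tuple b i p | i < s] by [].
apply/freeP => k kb i; apply: (orthonormal_indep heps (ob p) (k := k)).
rewrite -[RHS]kb; apply: eq_bigr => j _.
by rewrite -tnth_nth tnth_mktuple.
Qed.

Lemma frame_dim p : \dim (frame_span p) = s.
Proof.
have /andP[_ fr] := frame_basis p.
by move: fr; rewrite /free => /eqP ->; rewrite size_map size_enum_ord.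
Qed.

Lemma frame_spanP p x : x \in frame_span p ->
  x = \sum_i (sgn eps i * dot eps x (b i p)) *: b i p.
Proof.
move=> xE; have xk : x = \sum_i vector.coord [tuple b i p | i < s] i x *: b i p.
  have : x \in <<[tuple b i p | i < s]>>%VS by [].
  move=> /coord_span {1}->; apply: eq_bigr => j _.
  by rewrite -tnth_nth tnth_mktuple.
rewrite {1}xk; apply: eq_bigr => j _; congr (_ *: _); rewrite {2}xk.
exact: (esym (orthonormal_coef heps (fun j => vector.coord [tuple b i p | i < s] j x) j (ob p))).
Qed.

Lemma frame_normal c p x : A c -> dom c p -> x \in frame_span p ->
  normal_space eps f1 c p x.
Proof.
move=> Ac cp /frame_spanP -> t Tt; rewrite dot_suml big1 // => i _.
by have [_ _ nb] := pb i; rewrite dotZl (nb c p Ac cp t Tt) mulr0.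
Qed.

(** The derivatives of the [b i] are tangent and drop out: in a parallel frame the normal connection
    is plain differentiation of coefficients. The expansion is asked for on [U] only, since sections
    are local. *)
Lemma nabla_comb c (U : set M) (k : 'I_s -> M -> R) (eta : M -> 'rV[R]_N) u p :
  A c -> open U -> dom c p -> U p ->
  (forall i, differentiable (k i \o param c) (coord c p)) ->
  (forall q, dom c q -> U q -> eta q = \sum_i k i q *: b i q) ->
  nproj eps (tangent f1 c p) (pd c eta u p) = \sum_i pd c (k i) u p *: b i p.
Proof.
move=> Ac oU cp Up dk etaE; have hc := cP Ac.
have -> : pd c eta u p =
    \sum_i pd c (k i) u p *: b i p + \sum_i k i p *: pd c (b i) u p.
  rewrite (pd_near u hc oU cp Up etaE) /pd.
  rewrite (@derive_bigsum _ _ _ _ _ (fun i x => (k i \o param c) x *: (b i \o param c) x)).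
    rewrite -big_split /=; apply: eq_bigr => i _.
    rewrite (derive_scale u (dk i) (b_diff i Ac cp)) /= coordK //.
    by rewrite addrC.
  by move=> i; apply: differentiable_scale => //; exact: b_diff.
apply: (nproj_normal_add heps cP f1imm f11 Ac cp).
- have : forall l : seq 'I_s, tangent f1 c p (\sum_(i <- l) k i p *: pd c (b i) u p).
    elim=> [|i l [w _ IH]]; first by rewrite big_nil; exact: tangent0.
    have [_ tb _] := pb i; have [v _ vE] := tb c p u Ac cp.
    exists (k i p *: v + w) => //.
    by rewrite big_cons (pd_immersionP f1imm _ _ _ Ac cp) IH vE.
  exact.
- move=> t Tt; rewrite dot_suml big1 // => i _.
  by have [_ _ nb] := pb i; rewrite dotZl (nb c p Ac cp t Tt) mulr0.
Qed.

Lemma frame_normal_subbundle : normal_subbundle eps f1 A s frame_span.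
Proof.
split; [exact: frame_dim|by move=> c p xi; exact: frame_normal|].
move=> p; exists setT, b; split => //; first exact: openT.
- move=> i; split=> // q _; apply: memv_span.
  by apply/mapP; exists i => //; rewrite mem_enum.
- by move=> q _; exact: frame_basis.
Qed.

Let coefs (xi : M -> 'rV[R]_N) i q := sgn eps i * dot eps (xi q) (b i q).

Let coefs_smooth U xi i : open U -> section_on A frame_span U xi ->
  smooth_map_on A U (coefs xi i).
Proof.
move=> oU [sxi _] c Ac; have oI := open_coord_image (cP Ac) oU.
apply: (smoothM (a := fun=> sgn eps i)) => //; first exact: smooth_cst.
by apply: smooth_dot => //; [exact: sxi|exact: (@smooth_mapU _ _ _ _ _ U _ (b_smooth i) c Ac)].
Qed.

Let nabla_section U xi c p u : open U -> section_on A frame_span U xi ->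
  A c -> dom c p -> U p ->
  nabla_perp eps f1 c u xi p = \sum_i pd c (coefs xi i) u p *: b i p.
Proof.
move=> oU sxi Ac cp Up; apply: (nabla_comb u Ac oU cp Up).
  by move=> i; exact: (smooth_diff_param Ac cp Up (coefs_smooth i oU sxi)).
by move=> q cq Uq; exact: (frame_spanP (sxi.2 q Uq)).
Qed.

Lemma frame_parallel : parallel_subbundle eps f1 A frame_span.
Proof.
move=> U xi oU sxi c p u Ac cp Up.
rewrite (nabla_section u oU sxi Ac cp Up).
have -> : \sum_i pd c (coefs xi i) u p *: b i p =
    frame_iso p (\row_i pd c (coefs xi i) u p).
  by apply: eq_bigr => i _; rewrite mxE.
exact: frame_iso_in.
Qed.

(** In the parallel frame the curvature becomes the commutator of second derivatives of the
    coefficients. *)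
Lemma frame_flat : flat_subbundle eps f1 A frame_span.
Proof.
move=> U xi oU sxi c p u v Ac cp Up.
have H u' v' : nabla_perp eps f1 c u' (nabla_perp eps f1 c v' xi) p
    = \sum_i pd c (pd c (coefs xi i) v') u' p *: b i p.
  apply: (nabla_comb u' Ac oU cp Up).
    move=> i; apply: smooth_diff (smooth_pd v' (cP Ac) Ac oU (coefs_smooth i oU sxi)) _.
    by exists p.
  by move=> q cq Uq; exact: nabla_section sxi Ac cq Uq.
rewrite (H u v) (H v u); apply: eq_bigr => i _.
by rewrite (pd_symm u v (cP Ac) Ac oU cp Up (coefs_smooth i oU sxi)).
Qed.

Lemma frame_bundle_isometry : parallel_bundle_isometry eps f1 A frame_span frame_iso.
Proof.
split.
- move=> c Ac; have oI : open (img c `*` [set: 'rV[R]_s]).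
    by apply: open_prod; [exact: open_img (cP Ac)|exact: openT].
  apply: smooth_sum => // i; apply: smooth_scale => //.
    apply: (@smooth_snd _ _ _ _ _ _ (fun y : 'rV[R]_s => y 0 i)).
    by apply: smooth_coef; [exact: openT|exact: smooth_id].
  apply: (@smooth_fst _ _ _ _ _ _ (fun x => b i (param c x))).
  by move/smooth_mapT/(_ c Ac) : (b_smooth i).
- exact: frame_iso_in.
- exact: frame_iso_linear.
- exact: frame_iso_dot.
move=> c p u y Ac cp; rewrite /nabla_perp.
have dk i : differentiable ((fun=> y 0 i) \o param c) (coord c p).
  exact: differentiable_cst.
rewrite (nabla_comb u Ac openT cp I dk (eta := fun q => frame_iso q y)) //.
by rewrite big1 // => i _; rewrite pd_cst scale0r.
Qed.

End ParallelSections.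

(** * The converse *)

Section Converse.
Context {R : realType} (eps : R) (heps : eps = 1 \/ eps = -1) {N n0 n1 : nat}.
Context {M0 M1 : topologicalType}.
Context (A0 : set (chart M0 'rV[R]_n0)) (A1 : set (chart M1 'rV[R]_n1)).
Context (hA0 : smooth_atlas A0) (hA1 : smooth_atlas A1).
Context (cM0 : connected [set: M0]) (cM1 : connected [set: M1]).
Context (f : M0 * M1 -> 'rV[R]_N) (o0 : M0) (o1 : M1).
Hypothesis hf : polar_adapted_immersion eps A0 A1 f.

Let c0P c : A0 c -> is_chart c. Proof. by case: hA0 => + _ _; apply. Qed.
Let c1P c : A1 c -> is_chart c. Proof. by case: hA1 => + _ _; apply. Qed.
Let fimm : immersion (prod_atlas A0 A1) f. Proof. by case: hf. Qed.
Let fQ p : Q eps N (f p). Proof. by case: hf => _ /(_ p). Qed.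
Let ff p : dot eps (f p) (f p) = eps. Proof. by case: (fQ p). Qed.

Let f1 q := f (o0, q).
Let f1imm : immersion A1 f1. Proof. exact: (slice_immersion hA0 hf o0). Qed.
Let f11 p : dot eps (f1 p) (f1 p) = eps. Proof. exact: ff. Qed.

(** Every slice has the tangent spaces of [f1], so its derivative is tangent to [f1]; lying in the
    quadric, it is orthogonal to those same spaces. *)
Lemma slice_parallel_normal p0 : parallel_normal eps A1 f1 (fun q => f (p0, q)).
Proof.
have imm := slice_immersion hA0 hf p0.
have T c p : A1 c -> dom c p -> tangent f1 c p = tangent (fun q => f (p0, q)) c p.
  by move=> Ac cp; exact: (slice_tangent_const heps hA0 hA1 hf o0 p0 cM0 Ac cp).
split; first exact: imm.1.
- by move=> c p u Ac cp; rewrite (T c p Ac cp); exists u.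
- move=> c p Ac cp t; rewrite (T c p Ac cp) => Tt; rewrite dotC.
  exact: (tangent_orth c1P imm (fun q => ff (p0, q)) Ac cp).
Qed.

Lemma polar_immersion_data : exists (s : nat) (f1 : M1 -> 'rV[R]_N)
    (E : M1 -> {vspace 'rV[R]_N}) (phi : M1 -> 'rV[R]_s -> 'rV[R]_N)
    (e1 : 'rV[R]_s) (f0 : M0 -> 'rV[R]_s),
  polar_data eps A0 A1 f1 E phi e1 f0 /\ forall p0 p1, f (p0, p1) = phi p1 (f0 p0).
Proof.
have [s [b [b0 pb ob frame]]] := parallel_frame heps o1
  (fun a b c => parallel_normal_lin hA1 f1imm a (b := b) (b' := c))
  (fun b c p q => parallel_normal_dot hA1 p q cM1)
  (slice_parallel_normal o0) f11.
pose phi := frame_iso b.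
(* The coefficients may be read at [o1] because products of parallel normal fields are constant on
   [M1]; this is why [f0] depends on [p0] alone. *)
pose k p0 i := sgn eps i * dot eps (f (p0, o1)) (b i o1).
pose f0 p0 : 'rV[R]_s.+1 := \row_i k p0 i.
pose e1 : 'rV[R]_s.+1 := delta_mx 0 ord0.
have fE p0 p1 : f (p0, p1) = phi p1 (f0 p0).
  rewrite (frame _ p1 (slice_parallel_normal p0)); apply: eq_bigr => i _; rewrite mxE.
  congr (_ * _ *: _).
  exact: (parallel_normal_dot hA1 p1 o1 cM1 (slice_parallel_normal p0) (pb i)).
have f1E p1 : f1 p1 = phi p1 e1.
  rewrite /phi /frame_iso (bigD1 ord0) //= big1 => [|i i0].
    by rewrite mxE !eqxx scale1r addr0 b0.
  by rewrite mxE (negbTE i0) scale0r.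
have phi_dot p y z : dot eps (phi p y) (phi p z) = dot eps y z by exact: frame_iso_dot.
have Qe1 : Q eps s.+1 e1.
  split=> [|_ i i0]; first by rewrite dot_delta /e1 mxE eqxx mulr1.
  have -> : i = ord0 by apply: val_inj.
  by rewrite mxE !eqxx ltr01.
have f0_smooth : smooth_map_on A0 setT f0.
  have sf := smooth_slice1 o1 hA1 fimm.1.
  apply/smooth_mapT => c Ac; have oc := open_img (c0P Ac).
  have := sf c Ac; rewrite setIT -/(img c) => sfc.
  have f0E x : img c x -> \sum_i (k (param c x) i) *: delta_mx 0 i = f0 (param c x).
    move=> _; rewrite [RHS]row_sum_delta; apply: eq_bigr => i _; by rewrite mxE.
  apply: (smooth_eq oc f0E); apply: smooth_sum => // i.
  apply: smooth_scale => //; last exact: smooth_cst.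
  apply: (smoothM (a := fun=> sgn eps i)) => //; first exact: smooth_cst.
  by apply: smooth_dot => //; exact: smooth_cst.
have f0_imm : immersion A0 f0.
  split=> [|c p Ac cp u v uv]; first exact: f0_smooth.
  have [_ cov1 _] := hA1; have [c1 Ac1 d1] := cov1 o1.
  have slice w : pd c (fun q => f (q, o1)) w p = frame_iso b o1 (pd c f0 w p).
    have -> : (fun q => f (q, o1)) = (fun q => \sum_i f0 q 0 i *: b i o1).
      by apply/funext => q; exact: fE.
    by apply: pd_comb; exact: (smooth_diff_param Ac cp I f0_smooth).
  have := fimm.2 _ (p, o1) (prod_atlas_chart Ac Ac1) (conj cp d1) (u, 0) (v, 0).
  rewrite /= !(pd_prod1 c f _ p (c1P Ac1) d1) !slice (uv : pd c f0 u p = pd c f0 v p).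
  move=> /(_ erefl) H.
  by case: H.
(* Through [phi o1], the product of [e1] and [f0 p0] becomes that of two values of [f], which lie on
   the same sheet. *)
have Qf0 p0 : Q eps s.+1 (f0 p0).
  apply: (Q_timelike Qe1); first by rewrite -(phi_dot o1) -fE ff.
  by move=> e; rewrite -(phi_dot o1) -f1E -fE; exact: (Q_dot_lt0 heps e (fQ _) (fQ _)).
have om p0 : Omega eps f1 A1 phi (f0 p0 - e1).
  move=> c p Ac cp.
  have imm := slice_immersion hA0 hf p0.
  have T : tangent (fun q => f (p0, q)) c p = tangent f1 c p.
    exact: (slice_tangent_const heps hA0 hA1 hf p0 o0 cM0 Ac cp).
  pose G u := u - shape_op eps f1 c p (phi p (f0 p0 - e1)) u.
  have phiB q : phi q (f0 p0 - e1) = -1 *: f1 q + f (p0, q).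
    rewrite f1E fE /phi -scaleN1r addrC.
    exact: (frame_iso_linear b q (-1) e1 (f0 p0)).
  have [sb tb nb] := parallel_normal_lin hA1 f1imm (-1) (slice_parallel_normal o0)
    (slice_parallel_normal p0).
  (* [G] compares the differentials of [f1] and of the slice. Both are injective with the same
     image, so [G] is bijective, as [Omega] demands. *)
  have GE u : pd c f1 (G u) p = pd c (fun q => f (p0, q)) u p.
    have : tangent f1 c p (pd c (fun q => f (p0, q)) u p) by rewrite -T; exists u.
    move=> [w _ wE].
    have -> : G u = w.
      suff SO : shape_op eps f1 c p (-1 *: f1 p + f (p0, p)) u = u - w.
        by rewrite /G phiB SO opprB addrC subrK.
      apply: (shape_op_eq heps c1P f1imm f11
        (b := fun q => -1 *: f1 q + f (p0, q)) Ac cp sb).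
        by move=> q cq; exact: nb.
      rewrite -(pd_immersionN f1imm _ Ac cp) opprB (pd_immersionD f1imm _ _ Ac cp) wE.
      rewrite (pd_immersionN f1imm _ Ac cp).
      have d1 := immersion_diff f1imm Ac cp; have d2 := immersion_diff imm Ac cp.
      rewrite /pd (@deriveD _ _ _ (fun x => -1 *: (f1 \o param c) x)
        ((fun q => f (p0, q)) \o param c)).
      + rewrite (@derive_scale _ _ _ (fun=> -1) (f1 \o param c)) //.
        by rewrite derive_cst scale0r addr0 scaleN1r addrC.
      + by apply: diff_derivable; exact: (differentiable_scale (a := fun=> -1)).
      + exact: diff_derivable.
    exact: wE.
  have Ginj : injective G.
    move=> u v uv; apply: (imm.2 c p Ac cp).
    by rewrite /= -!GE uv.
  have Gsurj w : exists u, G u = w.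
    have : tangent (fun q => f (p0, q)) c p (pd c f1 w p) by rewrite T; exists w.
    move=> [u _ uE]; exists u; apply: (f1imm.2 c p Ac cp).
    by rewrite /= GE uE.
  have [G' G'K] := choice Gsurj.
  by exists G' => // u; apply: Ginj; rewrite G'K.
exists s.+1, f1, (frame_span b), phi, e1, f0; split; last exact: fE.
split.
- by split=> // p1; exact: fQ.
- split.
  + exact: frame_normal_subbundle.
  + exact: frame_parallel.
  + exact: frame_flat.
  + by move=> p1; rewrite f1E; exact: frame_iso_in.
- exact: frame_bundle_isometry.
- by split.
- by split=> // p0; split.
Qed.

End Converse.

Theorem corollary20 (R : realType) (eps : R) (heps : eps = 1 \/ eps = -1)
  (N n0 n1 : nat) (M0 M1 : topologicalType)
  (A0 : set (chart M0 'rV[R]_n0)) (A1 : set (chart M1 'rV[R]_n1))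
  (hM0 : smooth_manifold A0) (hM1 : smooth_manifold A1)
  (hM : [set: (M0 * M1)%type] !=set0 /\ connected [set: (M0 * M1)%type]) :
  (forall (s : nat) (f1 : M1 -> 'rV[R]_N) (E : M1 -> {vspace 'rV[R]_N})
      (phi : M1 -> 'rV[R]_s -> 'rV[R]_N) (e1 : 'rV[R]_s) (f0 : M0 -> 'rV[R]_s),
    polar_data eps A0 A1 f1 E phi e1 f0 ->
    polar_adapted_immersion eps A0 A1 (fun p => phi p.2 (f0 p.1)))
  /\
  (forall f : M0 * M1 -> 'rV[R]_N,
    polar_adapted_immersion eps A0 A1 f ->
    exists (s : nat) (f1 : M1 -> 'rV[R]_N) (E : M1 -> {vspace 'rV[R]_N})
      (phi : M1 -> 'rV[R]_s -> 'rV[R]_N) (e1 : 'rV[R]_s) (f0 : M0 -> 'rV[R]_s),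
      polar_data eps A0 A1 f1 E phi e1 f0 /\
      forall p0 p1, f (p0, p1) = phi p1 (f0 p0)).
Proof.
have [_ _ hA0] := hM0; have [_ _ hA1] := hM1.
(* The point of the product supplies the base points of both factors and makes the projections
   surjective, so connectedness descends. *)
have [[p _] cM] := hM.
have cM0 : connected [set: M0] by apply: connected_fst cM _; exists p.2.
have cM1 : connected [set: M1] by apply: connected_snd cM _; exists p.1.
split=> [s f1 E phi e1 f0|f hf]; first exact: polar_data_immersion.
exact: (polar_immersion_data heps hA0 hA1 cM0 cM1 p.1 p.2 hf).
Qed.
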